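(* Let $H$ be a Hopf algebra over a field $k$ with bijective antipode. Then there exists a central extension $B$ of $H$ such that any projective representation of $H$ afforded by a lazy 2-cocycle can be lifted to $B$.
   Context: Sweedler notation $\Delta(h)=h_1\otimes h_2$. For a Hopf subalgebra $K$ of a Hopf algebra, $K^+=K\cap\ker\varepsilon$. A central extension of $H$ is a Hopf algebra $B$ together with a central Hopf subalgebra $A$ such that the Hopf algebra quotient $B/BA^+$ is isomorphic to $H$; $\pi:B\to H$ denotes the corresponding surjection with kernel $BA^+$. A projective representation of $H$ on a vector space $V$ is a linear map $T:H\to\mathrm{End}(V)$ such that $T$ is convolution invertible, $T(1)=\mathrm{id}_V$, and $T(h)T(l)=\alpha(h_1,l_1)T(h_2l_2)$ for all $h,l\in H$, where $\alpha\in\mathrm{Hom}(H\otimes H,k)$ is convolution invertible; then $\alpha$ is a normalized left 2-cocycle and $T$ is said to be afforded by $\alpha$. Here a linear $\alpha:H\otimes H\to k$ is a left 2-cocycle if $\alpha(a_1,b_1)\alpha(a_2b_2,c)=\alpha(b_1,c_1)\alpha(a,b_2c_2)$, normalized if $\alpha(1,h)=\alpha(h,1)=\varepsilon(h)$, and lazy if $\alpha(h_1,h'_1)h_2h'_2=\alpha(h_2,h'_2)h_1h'_1$. A lazy 2-cocycle affording $T$ is thus a normalized and convolution invertible lazy left 2-cocycle. A projective representation $T:H\to\mathrm{End}(V)$ can be lifted to $B$ if there exist an algebra map $X:B\to\mathrm{End}(V)$ and a convolution invertible linear map $\gamma:B\to k$ with $\gamma(1)=1$ such that $X=\gamma*(T\circ\pi)$,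 i.e. $X(b)=\gamma(b_1)T(\pi(b_2))$ for all $b\in B$. *)

(* Defs.v *)
From HB Require Import structures.
From mathcomp Require Import all_boot all_order all_algebra.
From mathcomp Require Import boolp.
Set Implicit Arguments.
Unset Strict Implicit.
Unset Printing Implicit Defensive.
Import GRing.Theory.
Local Open Scope ring_scope.
Local Open Scope quotient_scope.

Notation is_bilinear b := (bilinear_for *:%R *:%R b).

Section BilinearSums.
Variables (k : fieldType) (U V W : lmodType k) (b : U -> V -> W).
Hypothesis bP : is_bilinear b.

Lemma bilin_linl v : linear (b^~ v). Proof. exact: bP.1. Qed.
Lemma bilin_linr u : linear (b u). Proof. exact: bP.2. Qed.

Lemma bilinZl a u v : b (a *: u) v = a *: b u v.
Proof. exact: (scalable_linear (bilin_linl v)). Qed.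
Lemma bilinZr a u v : b u (a *: v) = a *: b u v.
Proof. exact: (scalable_linear (bilin_linr u)). Qed.
Lemma bilinDl u u' v : b (u + u') v = b u v + b u' v.
Proof. by have:= bilin_linl v 1 u u'; rewrite !scale1r. Qed.
Lemma bilinDr u v v' : b u (v + v') = b u v + b u v'.
Proof. by have:= bilin_linr u 1 v v'; rewrite !scale1r. Qed.
Lemma bilin0l v : b 0 v = 0.
Proof. by rewrite -(scale0r 0) bilinZl scale0r. Qed.
Lemma bilin0r u : b u 0 = 0.
Proof. by rewrite -(scale0r 0) bilinZr scale0r. Qed.
Lemma bilin_suml (I : Type) (s : seq I) (F : I -> U) v :
  b (\sum_(i <- s) F i) v = \sum_(i <- s) b (F i) v.
Proof. by apply: (big_morph (b^~ v)) => [x y|]; rewrite ?bilinDl ?bilin0l. Qed.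
Lemma bilin_sumr (I : Type) (s : seq I) u (F : I -> V) :
  b u (\sum_(i <- s) F i) = \sum_(i <- s) b u (F i).
Proof. by apply: (big_morph (b u)) => [x y|]; rewrite ?bilinDr ?bilin0r. Qed.
End BilinearSums.

(* Tensor product of vector spaces: a sequence [:: (u_1, v_1); ...] stands for
   the formal sum of the u_i (x) v_i, and two formal sums are identified when
   no bilinear map separates them. The universal property is given by
   tensor_lift, tensor_liftE and tensor_lift_unique below. *)
Section Tensor.
Variables (k : fieldType) (U V : lmodType k).

Definition tensor_rel (s t : seq (U * V)) : bool :=
  `[< forall (W : lmodType k) (b : U -> V -> W), is_bilinear b ->
      \sum_(p <- s) b p.1 p.2 = \sum_(p <- t) b p.1 p.2 >].

Lemma tensor_rel_refl : reflexive tensor_rel.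
Proof. by move=> s; apply/asboolP. Qed.
Lemma tensor_rel_sym : symmetric tensor_rel.
Proof. by move=> s t; apply/asboolP/asboolP => h W b bP; rewrite h. Qed.
Lemma tensor_rel_trans : transitive tensor_rel.
Proof.
move=> s t r /asboolP h1 /asboolP h2; apply/asboolP => W b bP.
by rewrite h1 // h2.
Qed.
Canonical tensor_equiv :=
  EquivRel tensor_rel tensor_rel_refl tensor_rel_sym tensor_rel_trans.

Definition tensor : Type := {eq_quot tensor_equiv}.
HB.instance Definition _ := Choice.on tensor.
HB.instance Definition _ := EqQuotient.on tensor.

Lemma tensorP (s t : seq (U * V)) :
  (forall (W : lmodType k) (b : U -> V -> W), is_bilinear b ->
      \sum_(p <- s) b p.1 p.2 = \sum_(p <- t) b p.1 p.2) <->
  \pi_tensor s = \pi_tensor t.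
Proof.
split=> [h|/eqquotP/asboolP//].
by apply/eqquotP/asboolP.
Qed.

Definition tensor_sum (W : lmodType k) (b : U -> V -> W) (t : tensor) : W :=
  \sum_(p <- repr t) b p.1 p.2.

Lemma tensor_sum_pi (W : lmodType k) (b : U -> V -> W) s : is_bilinear b ->
  tensor_sum b (\pi_tensor s) = \sum_(p <- s) b p.1 p.2.
Proof. by move=> bP; apply: (tensorP _ _).2 bP; exact: reprK. Qed.

Definition tzero : tensor := \pi_tensor [::].
Definition tadd (t u : tensor) : tensor := \pi_tensor (repr t ++ repr u).
Definition tscale (a : k) (t : tensor) : tensor :=
  \pi_tensor [seq (a *: p.1, p.2) | p <- repr t].
Definition topp (t : tensor) : tensor := tscale (-1) t.

Local Notation ts := tensor_sum.
Lemma tensor_ext (t u : tensor) :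
  (forall (W : lmodType k) (b : U -> V -> W), is_bilinear b -> ts b t = ts b u)
  -> t = u.
Proof. by move=> h; rewrite -[t]reprK -[u]reprK; apply/tensorP => W b /h. Qed.

Lemma ts0 (W : lmodType k) (b : U -> V -> W) : is_bilinear b -> ts b tzero = 0.
Proof. by move=> bP; rewrite tensor_sum_pi // big_nil. Qed.
Lemma tsD (W : lmodType k) (b : U -> V -> W) t u : is_bilinear b ->
  ts b (tadd t u) = ts b t + ts b u.
Proof. by move=> bP; rewrite tensor_sum_pi // big_cat. Qed.
Lemma tsZ (W : lmodType k) (b : U -> V -> W) a t : is_bilinear b ->
  ts b (tscale a t) = a *: ts b t.
Proof.
move=> bP; rewrite tensor_sum_pi // big_map scaler_sumr.
by apply: eq_bigr => p _ /=; rewrite bilinZl.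
Qed.

Fact taddA : associative tadd.
Proof. by move=> x y z; apply: tensor_ext => W b bP; rewrite !tsD // addrA. Qed.
Fact taddC : commutative tadd.
Proof. by move=> x y; apply: tensor_ext => W b bP; rewrite !tsD // addrC. Qed.
Fact tadd0 : left_id tzero tadd.
Proof. by move=> x; apply: tensor_ext => W b bP; rewrite tsD // ts0 // add0r. Qed.
Fact taddN : left_inverse tzero topp tadd.
Proof.
by move=> x; apply: tensor_ext => W b bP; rewrite tsD // tsZ // ts0 // scaleN1r addNr.
Qed.
HB.instance Definition _ := GRing.isZmodule.Build tensor taddA taddC tadd0 taddN.

Fact tscaleA a b t : tscale a (tscale b t) = tscale (a * b) t.
Proof. by apply: tensor_ext => W f fP; rewrite !tsZ // scalerA. Qed.
Fact tscale1 : left_id 1 tscale.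
Proof. by move=> x; apply: tensor_ext => W b bP; rewrite tsZ // scale1r. Qed.
Fact tscaleDr : right_distributive tscale +%R.
Proof.
by move=> a x y; apply: tensor_ext => W b bP; rewrite !(tsZ, tsD) // scalerDr.
Qed.
Fact tscaleDl t : {morph tscale^~ t : a b / a + b}.
Proof.
by move=> a c; apply: tensor_ext => W b bP; rewrite !(tsZ, tsD) // scalerDl.
Qed.
HB.instance Definition _ :=
  GRing.Zmodule_isLmodule.Build k tensor tscaleA tscale1 tscaleDr tscaleDl.

Definition tens (u : U) (v : V) : tensor := \pi_tensor [:: (u, v)].

Lemma tensor_sum_linear (W : lmodType k) (b : U -> V -> W) :
  is_bilinear b -> linear (tensor_sum b).
Proof. by move=> bP a t u; rewrite [LHS]tsD // tsZ. Qed.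

Lemma tensor_sumE (W : lmodType k) (b : U -> V -> W) u v :
  is_bilinear b -> tensor_sum b (tens u v) = b u v.
Proof. by move=> bP; rewrite tensor_sum_pi // big_seq1. Qed.

Lemma tens_bilinear : is_bilinear tens.
Proof.
split=> [v a u u'|u a v v']; apply: tensor_ext => W b bP;
  rewrite tensor_sum_linear // !tensor_sumE //.
- by rewrite (bilin_linl bP).
- by rewrite (bilin_linr bP).
Qed.

Lemma tensor_sum_sum (W : lmodType k) (b : U -> V -> W) (I : Type) (s : seq I) F :
  is_bilinear b ->
  tensor_sum b (\sum_(i <- s) F i) = \sum_(i <- s) tensor_sum b (F i).
Proof.
move=> bP; apply: (big_morph (tensor_sum b)) => [x y|].
  exact: tsD.
exact: ts0.
Qed.

Lemma tensor_repr (t : tensor) : t = \sum_(p <- repr t) tens p.1 p.2.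
Proof.
apply: tensor_ext => W b bP; rewrite tensor_sum_sum //.
by apply: eq_bigr => p _; rewrite tensor_sumE.
Qed.

Definition tensor_lift (W : lmodType k) (b : U -> V -> W) (bP : is_bilinear b)
  : tensor -> W := tensor_sum b.
HB.instance Definition _ (W : lmodType k) (b : U -> V -> W) (bP : is_bilinear b) :=
  GRing.isLinear.Build k tensor W *:%R (@tensor_lift W b bP)
    (tensor_sum_linear bP).

Lemma tensor_liftE (W : lmodType k) (b : U -> V -> W) (bP : is_bilinear b) u v :
  tensor_lift bP (tens u v) = b u v.
Proof. exact: tensor_sumE. Qed.

Lemma tensor_lift_unique (W : lmodType k) (b : U -> V -> W) (bP : is_bilinear b)
    (f : {linear tensor -> W}) :
  (forall u v, f (tens u v) = b u v) -> f =1 tensor_lift bP.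
Proof.
move=> fE t; rewrite {1}(tensor_repr t) linear_sum.
by apply: eq_bigr => p _; rewrite fE.
Qed.

End Tensor.

Arguments tens {k U V} u v.
Notation "u ⊗ v" := (tens u v) (at level 40, left associativity) : ring_scope.

Section TensorTheory.
Variables (k : fieldType) (U V : lmodType k).

Lemma tensor_ind (P : tensor U V -> Prop) :
  P 0 -> (forall x y, P x -> P y -> P (x + y)) -> (forall u v, P (u ⊗ v)) ->
  forall t, P t.
Proof.
move=> P0 PD Pt t; rewrite (tensor_repr t).
by elim/big_ind: _ => // p _; apply: Pt.
Qed.

Lemma linear_ext_tensor (W : lmodType k) (f g : tensor U V -> W) :
  linear f -> linear g -> (forall u v, f (u ⊗ v) = g (u ⊗ v)) -> f =1 g.
Proof.
move=> fL gL fg.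
have h (e : tensor U V -> W) : linear e ->
    e 0 = 0 /\ {morph e : x y / x + y}.
  move=> eL; split=> [|x y].
    by have := eL (-1) 0 0; rewrite scaler0 addr0 scaleN1r addNr.
  by have := eL 1 x y; rewrite !scale1r.
have [f0 fD] := h f fL; have [g0 gD] := h g gL.
by elim/tensor_ind => [|x y xE yE|//]; rewrite ?f0 ?g0 // fD gD xE yE.
Qed.

Lemma tensor_sum_eq (W : lmodType k) (b : U -> V -> W) (s : seq (U * V)) t :
  is_bilinear b -> t = \sum_(p <- s) p.1 ⊗ p.2 ->
  tensor_sum b t = \sum_(p <- s) b p.1 p.2.
Proof.
move=> bP ->; rewrite tensor_sum_sum //.
by apply: eq_bigr => p _; rewrite tensor_sumE.
Qed.

Lemma eq_tensor_sum (W : lmodType k) (b b' : U -> V -> W) :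
  b =2 b' -> tensor_sum b =1 tensor_sum b'.
Proof. by move=> e t; apply: eq_bigr => p _; rewrite e. Qed.

Lemma bilinear_sum (W : lmodType k) (I : Type) (s : seq I) (b : I -> U -> V -> W) :
  (forall i, is_bilinear (b i)) ->
  is_bilinear (fun u v => \sum_(i <- s) b i u v).
Proof.
move=> bP; split=> [v a u u'|u a v v']; rewrite /= scaler_sumr -big_split.
  by apply: eq_bigr => i _; apply: (bP i).1.
by apply: eq_bigr => i _; apply: (bP i).2.
Qed.

Lemma linear_sum_fun (W : lmodType k) (I : Type) (s : seq I) (b : I -> U -> W) :
  (forall i, linear (b i)) -> linear (fun u => \sum_(i <- s) b i u).
Proof.
move=> bP a x y; rewrite /= scaler_sumr -big_split.
by apply: eq_bigr => i _; apply: bP.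
Qed.
End TensorTheory.

Section TensorAlgebra.
Variables (k : fieldType) (A B : algType k).

Definition tmul (t u : tensor A B) : tensor A B :=
  \sum_(p <- repr t) \sum_(q <- repr u) (p.1 * q.1) ⊗ (p.2 * q.2).

Let mulA_bilin (x : A) (y : B) :
  is_bilinear (fun a b => (x * a) ⊗ (y * b) : tensor A B).
Proof.
split=> [v a u u'|u a v v']; rewrite /= mulrDr -scalerAr.
  exact: (tens_bilinear A B).1.
exact: (tens_bilinear A B).2.
Qed.

Let mulA_bilinl (u : tensor A B) :
  is_bilinear (fun a b => \sum_(q <- repr u) (a * q.1) ⊗ (b * q.2) : tensor A B).
Proof.
apply: bilinear_sum => q.
split=> [v a x y|x a v v']; rewrite /= mulrDl -scalerAl.
  exact: (tens_bilinear A B).1.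
exact: (tens_bilinear A B).2.
Qed.

Lemma tmul_bilinear : is_bilinear tmul.
Proof.
split=> [u|t]; first exact: tensor_sum_linear (mulA_bilinl u).
apply: linear_sum_fun => p; exact: tensor_sum_linear (mulA_bilin _ _).
Qed.

Lemma tmulE a b a' b' : tmul (a ⊗ b) (a' ⊗ b') = (a * a') ⊗ (b * b').
Proof.
by rewrite [LHS](tensor_sumE _ _ (mulA_bilinl _)) [LHS](tensor_sumE _ _ (mulA_bilin _ _)).
Qed.

Fact tmulDl : left_distributive tmul +%R.
Proof. by move=> x y z; apply: bilinDl tmul_bilinear _ _ _. Qed.
Fact tmulDr : right_distributive tmul +%R.
Proof. by move=> x y z; apply: bilinDr tmul_bilinear _ _ _. Qed.
Let tmul0l x : tmul 0 x = 0. Proof. exact: bilin0l tmul_bilinear _. Qed.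
Let tmul0r x : tmul x 0 = 0. Proof. exact: bilin0r tmul_bilinear _. Qed.

Fact tmulA : associative tmul.
Proof.
elim/tensor_ind => [|x x' IH IH'|a b] y z; first by rewrite !tmul0l.
  by rewrite !tmulDl IH IH'.
elim/tensor_ind: y => [|x x' IH IH'|a' b']; first by rewrite !(tmul0l, tmul0r).
  by rewrite !(tmulDl, tmulDr) IH IH'.
elim/tensor_ind: z => [|x x' IH IH'|c d]; first by rewrite !tmul0r.
  by rewrite !tmulDr IH IH'.
by rewrite !tmulE !mulrA.
Qed.
Fact tmul1l : left_id (1 ⊗ 1) tmul.
Proof.
elim/tensor_ind => [|x y IH IH'|a b]; first by rewrite tmul0r.
  by rewrite tmulDr IH IH'.
by rewrite tmulE !mul1r.
Qed.
Fact tmul1r : right_id (1 ⊗ 1) tmul.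
Proof.
elim/tensor_ind => [|x y IH IH'|a b]; first by rewrite tmul0l.
  by rewrite tmulDl IH IH'.
by rewrite tmulE !mulr1.
Qed.
HB.instance Definition _ := GRing.Zmodule_isPzRing.Build (tensor A B)
  tmulA tmul1l tmul1r tmulDl tmulDr.
End TensorAlgebra.

(* Sweedler's h_1 ⊗ h_2 is the chosen representative of comul h. Sums over it
   do not depend on the choice when the summand is multilinear. *)
HB.mixin Record Lmodule_isCoalgebra (k : fieldType) C of GRing.Lmodule k C := {
  comul : {linear C -> tensor C C};
  counit : {linear C -> k^o};
  comulA : forall c : C,
    \sum_(p <- repr (comul c)) \sum_(q <- repr (comul p.1)) q.1 ⊗ (q.2 ⊗ p.2)
    = \sum_(p <- repr (comul c)) \sum_(q <- repr (comul p.2)) p.1 ⊗ (q.1 ⊗ q.2);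
  comul_counitl : forall c : C,
    \sum_(p <- repr (comul c)) (counit p.1 : k) *: p.2 = c;
  comul_counitr : forall c : C,
    \sum_(p <- repr (comul c)) (counit p.2 : k) *: p.1 = c
}.
#[short(type="coalgType")]
HB.structure Definition Coalgebra (k : fieldType) :=
  {C of Lmodule_isCoalgebra k C & GRing.Lmodule k C}.

Definition sweedler (k : fieldType) (C : coalgType k) (c : C) : seq (C * C) :=
  repr (comul c).

Lemma sweedler_coassoc (k : fieldType) (C : coalgType k) (W : lmodType k)
    (F : C -> C -> C -> W) (c : C) :
  (forall y z, linear (fun x => F x y z)) -> (forall x, is_bilinear (F x)) ->
  \sum_(p <- sweedler c) \sum_(q <- sweedler p.1) F q.1 q.2 p.2
  = \sum_(p <- sweedler c) \sum_(q <- sweedler p.2) F p.1 q.1 q.2.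
Proof.
move=> F1 F2; pose G x := tensor_sum (F x).
have GP : is_bilinear G.
  split=> [u|x]; last exact: tensor_sum_linear.
  by apply: linear_sum_fun => p; apply: F1.
have := congr1 (tensor_sum G) (comulA c).
rewrite !tensor_sum_sum //.
under eq_bigr => p _.
  rewrite tensor_sum_sum //.
  under eq_bigr => q _ do rewrite tensor_sumE // /G tensor_sumE //.
over.
under [RHS]eq_bigr => p _.
  rewrite tensor_sum_sum //.
  under eq_bigr => q _ do rewrite tensor_sumE // /G tensor_sumE //.
over.
by [].
Qed.


Lemma sweedler_linear (k : fieldType) (C : coalgType k) (W : lmodType k)
    (b : C -> C -> W) :
  is_bilinear b -> linear (fun c => \sum_(p <- sweedler c) b p.1 p.2).
Proof.
move=> bP a x y; rewrite /sweedler linearP.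
exact: tensor_sum_linear.
Qed.

Lemma sweedler_eq (k : fieldType) (C : coalgType k) (W : lmodType k)
    (b : C -> C -> W) (s : seq (C * C)) c :
  is_bilinear b -> comul c = \sum_(p <- s) p.1 ⊗ p.2 ->
  \sum_(p <- sweedler c) b p.1 p.2 = \sum_(p <- s) b p.1 p.2.
Proof. exact: tensor_sum_eq. Qed.

Section TensorCoalgebra.
Variables (k : fieldType) (C D : coalgType k).
Local Notation CD := (tensor C D).

Definition tcomul (t : CD) : tensor CD CD :=
  \sum_(p <- repr t) \sum_(q <- sweedler p.1) \sum_(r <- sweedler p.2)
    (q.1 ⊗ r.1) ⊗ (q.2 ⊗ r.2).
Definition tcounit (t : CD) : k^o :=
  \sum_(p <- repr t) counit p.1 * counit p.2.

Let tensDl (X Y : lmodType k) (v : Y) : linear (fun u : X => u ⊗ v).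
Proof. exact: (tens_bilinear X Y).1. Qed.
Let tensDr (X Y : lmodType k) (u : X) : linear (fun v : Y => u ⊗ v).
Proof. exact: (tens_bilinear X Y).2. Qed.

Let tens4l (r : D * D) :
  is_bilinear (fun x y : C => (x ⊗ r.1) ⊗ (y ⊗ r.2)).
Proof. by split=> [v a x x'|v a x x'] /=; rewrite !(tensDl, tensDr). Qed.
Let tens4r (q : C * C) :
  is_bilinear (fun x y : D => (q.1 ⊗ x) ⊗ (q.2 ⊗ y)).
Proof. by split=> [v a x x'|v a x x'] /=; rewrite !(tensDl, tensDr). Qed.

Lemma tcomul_bilinear : is_bilinear (fun (c : C) (d : D) =>
  \sum_(q <- sweedler c) \sum_(r <- sweedler d) (q.1 ⊗ r.1) ⊗ (q.2 ⊗ r.2)).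
Proof.
split=> [d|c].
  apply: (sweedler_linear (b := fun x y => \sum_(r <- sweedler d) (x ⊗ r.1) ⊗ (y ⊗ r.2))).
  by apply: bilinear_sum => r; apply: tens4l.
apply: linear_sum_fun => q.
exact: (sweedler_linear (b := fun x y => (q.1 ⊗ x) ⊗ (q.2 ⊗ y)) (tens4r q)).
Qed.

Lemma tcounit_bilinear :
  is_bilinear (fun (c : C) (d : D) => counit c * counit d : k^o).
Proof.
split=> [d a x y|c a x y] /=; rewrite linearP /=.
  by rewrite mulrDl -mulrA.
by rewrite mulrDr mulrCA.
Qed.

Lemma tcomul_linear : linear tcomul.
Proof. exact: tensor_sum_linear tcomul_bilinear. Qed.
Lemma tcounit_linear : linear tcounit.
Proof. exact: tensor_sum_linear tcounit_bilinear. Qed.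

HB.instance Definition _ :=
  GRing.isLinear.Build k CD (tensor CD CD) *:%R tcomul tcomul_linear.
HB.instance Definition _ := GRing.isLinear.Build k CD k^o *:%R tcounit tcounit_linear.

Lemma tcomulE c d : tcomul (c ⊗ d) =
  \sum_(q <- sweedler c) \sum_(r <- sweedler d) (q.1 ⊗ r.1) ⊗ (q.2 ⊗ r.2).
Proof. exact: tensor_sumE tcomul_bilinear. Qed.
Lemma tcounitE c d : tcounit (c ⊗ d) = counit c * counit d.
Proof. exact: tensor_sumE tcounit_bilinear. Qed.

Lemma tcomul_sum (W : lmodType k) (G : CD -> CD -> W) c d : is_bilinear G ->
  \sum_(p <- repr (tcomul (c ⊗ d))) G p.1 p.2
  = \sum_(q <- sweedler c) \sum_(r <- sweedler d) G (q.1 ⊗ r.1) (q.2 ⊗ r.2).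
Proof.
move=> GP; rewrite tcomulE [LHS]tensor_sum_sum //.
by apply: eq_bigr => q _; rewrite tensor_sum_sum //;
   apply: eq_bigr => r _; rewrite tensor_sumE.
Qed.

Lemma tcomulA t :
  \sum_(p <- repr (tcomul t)) \sum_(q <- repr (tcomul p.1)) q.1 ⊗ (q.2 ⊗ p.2)
  = \sum_(p <- repr (tcomul t)) \sum_(q <- repr (tcomul p.2)) p.1 ⊗ (q.1 ⊗ q.2).
Proof.
pose L3 (z : CD) x y : tensor CD (tensor CD CD) := x ⊗ (y ⊗ z).
pose R3 (x : CD) y z : tensor CD (tensor CD CD) := x ⊗ (y ⊗ z).
have L3P z : is_bilinear (L3 z).
  by split=> [v a x y|v a x y]; rewrite /L3 /= !(tensDl, tensDr).
have R3P x : is_bilinear (R3 x).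
  by split=> [v a y z|v a y z]; rewrite /R3 /= !(tensDl, tensDr).
pose GL (x z : CD) := \sum_(q <- repr (tcomul x)) L3 z q.1 q.2.
pose GR (x y : CD) := \sum_(q <- repr (tcomul y)) R3 x q.1 q.2.
have GLP : is_bilinear GL.
  split=> [z a x y|x]; last by apply: linear_sum_fun => q a y z; rewrite /L3 !tensDr.
  by rewrite /GL linearP [LHS]tensor_sum_linear.
have GRP : is_bilinear GR.
  split=> [y|x a y z]; first by apply: linear_sum_fun => q a x x'; rewrite /R3 !tensDl.
  by rewrite /GR linearP [LHS]tensor_sum_linear.
have LL : linear (fun t => \sum_(p <- repr (tcomul t)) GL p.1 p.2).
  by move=> a x y; rewrite linearP [LHS]tensor_sum_linear.
have RL : linear (fun t => \sum_(p <- repr (tcomul t)) GR p.1 p.2).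
  by move=> a x y; rewrite linearP [LHS]tensor_sum_linear.
apply: (linear_ext_tensor LL RL) => c d.
rewrite !tcomul_sum //.
under eq_bigr => q _ do under eq_bigr => r _ do rewrite /GL tcomul_sum //.
under [RHS]eq_bigr => q _ do under eq_bigr => r _ do rewrite /GR tcomul_sum //.
pose F (x y z : C) := \sum_(r <- sweedler d) \sum_(r' <- sweedler r.1)
   L3 (z ⊗ r.2) (x ⊗ r'.1) (y ⊗ r'.2).
have F1 y z : linear (fun x => F x y z).
  apply: linear_sum_fun => r; apply: linear_sum_fun => r' a x x'.
  by rewrite /L3 !tensDl.
have F2 x : is_bilinear (F x).
  apply: bilinear_sum => r; apply: bilinear_sum => r'.
  by split=> [v a y z|v a y z]; rewrite /L3 /= !(tensDl, tensDr).
transitivity (\sum_(p <- sweedler c) \sum_(q <- sweedler p.1) F q.1 q.2 p.2).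
  by apply: eq_bigr => p _; rewrite exchange_big.
rewrite (sweedler_coassoc c F1 F2); apply: eq_bigr => p _.
rewrite [RHS]exchange_big; apply: eq_bigr => q _.
pose F' (x y z : D) := L3 (q.2 ⊗ z) (p.1 ⊗ x) (q.1 ⊗ y).
apply: (sweedler_coassoc (F := F')) => [y z a x x'|x].
  by rewrite /F' /L3 !(tensDl, tensDr).
by split=> [v a y z|v a y z]; rewrite /F' /L3 /= !(tensDl, tensDr).
Qed.

Lemma tcomul_counitl t : \sum_(p <- repr (tcomul t)) tcounit p.1 *: p.2 = t.
Proof.
have bP : is_bilinear (fun x y : CD => (tcounit x : k) *: y).
  split=> [v a x y|v a x y] /=.
    by rewrite linearP /= scalerDl -scalerA.
  by rewrite scalerDr !scalerA mulrC.
move: t; apply: (linear_ext_tensor (g := idfun)) => [a x y|//|c d].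
  by rewrite linearP; apply: (tensor_sum_linear bP).
rewrite [LHS](tcomul_sum _ _ bP) /= -[c in RHS](comul_counitl c) -[d in RHS](comul_counitl d).
rewrite (bilin_suml (tens_bilinear C D)); apply: eq_bigr => q _.
rewrite (bilin_sumr (tens_bilinear C D)); apply: eq_bigr => r _.
rewrite (bilinZl (tens_bilinear C D)) (bilinZr (tens_bilinear C D)).
by rewrite tcounitE scalerA.
Qed.

Lemma tcomul_counitr t : \sum_(p <- repr (tcomul t)) tcounit p.2 *: p.1 = t.
Proof.
have bP : is_bilinear (fun x y : CD => (tcounit y : k) *: x).
  split=> [v a x y|v a x y] /=.
    by rewrite scalerDr !scalerA mulrC.
  by rewrite linearP /= scalerDl -scalerA.
move: t; apply: (linear_ext_tensor (g := idfun)) => [a x y|//|c d].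
  by rewrite linearP; apply: (tensor_sum_linear bP).
rewrite [LHS](tcomul_sum _ _ bP) /= -[c in RHS](comul_counitr c) -[d in RHS](comul_counitr d).
rewrite (bilin_suml (tens_bilinear C D)); apply: eq_bigr => q _.
rewrite (bilin_sumr (tens_bilinear C D)); apply: eq_bigr => r _.
rewrite (bilinZl (tens_bilinear C D)) (bilinZr (tens_bilinear C D)).
by rewrite tcounitE scalerA.
Qed.

HB.instance Definition _ := Lmodule_isCoalgebra.Build k CD
  tcomulA tcomul_counitl tcomul_counitr.

End TensorCoalgebra.

HB.mixin Record Algebra_Coalgebra_isHopf (k : fieldType) H
    of GRing.Algebra k H & Coalgebra k H := {
  comul_monoid_morphism : monoid_morphism (comul : H -> tensor H H);
  counit_monoid_morphism : monoid_morphism (counit : H -> k);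
  antipode : {linear H -> H};
  antipodel : forall h : H,
    \sum_(p <- sweedler h) antipode p.1 * p.2 = (counit h : k)%:A;
  antipoder : forall h : H,
    \sum_(p <- sweedler h) p.1 * antipode p.2 = (counit h : k)%:A
}.
#[short(type="hopfAlgType")]
HB.structure Definition HopfAlgebra (k : fieldType) :=
  {H of Algebra_Coalgebra_isHopf k H & GRing.Algebra k H & Coalgebra k H}.

(* The library's {linear V -> V} carries no ring structure. End(V) is only a
   pzRingType because V = 0 is allowed. *)
Definition End (k : fieldType) (V : lmodType k) : Type := {linear V -> V}.

Section EndAlgebra.
Variables (k : fieldType) (V : lmodType k).
Local Notation E := (End V).

HB.instance Definition _ := gen_eqMixin E.
HB.instance Definition _ := gen_choiceMixin E.

Definition End_fun (f : E) : V -> V := (f : {linear V -> V}).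

Lemma End_ext (f g : E) : End_fun f =1 End_fun g -> f = g.
Proof.
case: f g => [f [[fD] [fZ]]] [g [[gD] [gZ]]] /funext /= E; subst g.
by rewrite (Prop_irrelevance fD gD) (Prop_irrelevance fZ gZ).
Qed.

Definition End0 : E := \0.
Definition End1 : E := idfun.
Definition EndD (f g : E) : E :=
  (f : {linear V -> V}) \+ (g : {linear V -> V}).
Definition EndN (f : E) : E := \- (f : {linear V -> V}).
Definition EndZ (a : k) (f : E) : E := a \*: (f : {linear V -> V}).
Definition EndM (f g : E) : E := (f : {linear V -> V}) \o (g : {linear V -> V}).

Fact EndDA : associative EndD.
Proof. by move=> f g h; apply: End_ext => v; apply: addrA. Qed.
Fact EndDC : commutative EndD.
Proof. by move=> f g; apply: End_ext => v; apply: addrC. Qed.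
Fact EndD0 : left_id End0 EndD.
Proof. by move=> f; apply: End_ext => v; apply: add0r. Qed.
Fact EndDN : left_inverse End0 EndN EndD.
Proof. by move=> f; apply: End_ext => v; apply: addNr. Qed.
HB.instance Definition _ := GRing.isZmodule.Build E EndDA EndDC EndD0 EndDN.

Fact EndMA : associative EndM.
Proof. by move=> f g h; apply: End_ext. Qed.
Fact End1M : left_id End1 EndM.
Proof. by move=> f; apply: End_ext. Qed.
Fact EndM1 : right_id End1 EndM.
Proof. by move=> f; apply: End_ext. Qed.
Fact EndMDl : left_distributive EndM EndD.
Proof. by move=> f g h; apply: End_ext. Qed.
Fact EndMDr : right_distributive EndM EndD.
Proof.
by move=> f g h; apply: End_ext => v; apply: (linearD (f : {linear V -> V})).
Qed.
HB.instance Definition _ :=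
  GRing.Zmodule_isPzRing.Build E EndMA End1M EndM1 EndMDl EndMDr.

Fact EndZA a b f : EndZ a (EndZ b f) = EndZ (a * b) f.
Proof. by apply: End_ext => v; apply: scalerA. Qed.
Fact EndZ1 : left_id 1 EndZ.
Proof. by move=> f; apply: End_ext => v; apply: scale1r. Qed.
Fact EndZDr : right_distributive EndZ +%R.
Proof. by move=> a f g; apply: End_ext => v; apply: scalerDr. Qed.
Fact EndZDl f : {morph EndZ^~ f : a b / a + b}.
Proof. by move=> a b; apply: End_ext => v; apply: scalerDl. Qed.
HB.instance Definition _ :=
  GRing.Zmodule_isLmodule.Build k E EndZA EndZ1 EndZDr EndZDl.

Lemma End_scalerAl a (f g : E) : a *: (f * g) = (a *: f) * g.
Proof. by apply: End_ext. Qed.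
Lemma End_scalerAr a (f g : E) : a *: (f * g) = f * (a *: g).
Proof.
apply: End_ext => v; apply: esym; exact: (linearZ_LR (f : {linear V -> V})).
Qed.
End EndAlgebra.

Section Convolution.
Variable k : fieldType.

Definition convolution (C : coalgType k) (A : pzRingType) (f g : C -> A) (c : C) : A :=
  \sum_(p <- sweedler c) f p.1 * g p.2.

(* Invertibility in Hom(C, k) and in Hom(C, End(V)). The unit of Hom(C, A) is
   c |-> counit c *: 1. *)
Definition conv_invertible (C : coalgType k) (f : {linear C -> k^o}) : Prop :=
  exists g : {linear C -> k^o}, forall c,
    convolution f g c = counit c /\ convolution g f c = counit c.

Definition conv_invertible_End (C : coalgType k) (V : lmodType k)
    (f : {linear C -> End V}) : Prop :=
  exists g : {linear C -> End V}, forall c,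
    convolution f g c = (counit c : k) *: (1 : End V) :> End V /\
    convolution g f c = (counit c : k) *: (1 : End V) :> End V.
End Convolution.

Section Cocycles.
Variables (k : fieldType) (H : hopfAlgType k).
Implicit Type alpha : {linear tensor H H -> k^o}.

Definition left_2cocycle alpha : Prop := forall a b c : H,
  \sum_(p <- sweedler a) \sum_(q <- sweedler b)
     alpha (p.1 ⊗ q.1) * alpha ((p.2 * q.2) ⊗ c)
  = \sum_(q <- sweedler b) \sum_(r <- sweedler c)
     alpha (q.1 ⊗ r.1) * alpha (a ⊗ (q.2 * r.2)).

Definition normalized alpha : Prop := forall h : H,
  alpha (1 ⊗ h) = counit h /\ alpha (h ⊗ 1) = counit h.

Definition lazy alpha : Prop := forall h h' : H,
  \sum_(p <- sweedler h) \sum_(q <- sweedler h')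
     (alpha (p.1 ⊗ q.1) : k) *: (p.2 * q.2)
  = \sum_(p <- sweedler h) \sum_(q <- sweedler h')
     (alpha (p.2 ⊗ q.2) : k) *: (p.1 * q.1).

Definition affords (V : lmodType k) alpha (T : {linear H -> End V}) : Prop :=
  forall h l : H, T h * T l =
    \sum_(p <- sweedler h) \sum_(q <- sweedler l)
      (alpha (p.1 ⊗ q.1) : k) *: T (p.2 * q.2).

Definition projective_representation (V : lmodType k) (T : {linear H -> End V}) :=
  [/\ conv_invertible_End T, T 1 = 1 &
      exists alpha, conv_invertible alpha /\ affords alpha T].

(* For V != 0 the cocycle and normalization clauses follow from affords; for
   V = 0 they do not. *)
Definition afforded_by_lazy_2cocycle (V : lmodType k) (T : {linear H -> End V}) :=
  exists alpha,
    [/\ left_2cocycle alpha, normalized alpha, lazy alpha,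
        conv_invertible alpha & affords alpha T].
End Cocycles.

Section CentralExtensions.
Variable k : fieldType.

Record hopf_subalgebra (B : hopfAlgType k) (A : B -> Prop) : Prop := {
  hopf_sub1 : A 1;
  hopf_subP : forall (c : k) a b, A a -> A b -> A (c *: a + b);
  hopf_subM : forall a b, A a -> A b -> A (a * b);
  hopf_sub_comul : forall a, A a -> exists s : seq (B * B),
    (forall p, p \in s -> A p.1 /\ A p.2) /\ comul a = \sum_(p <- s) p.1 ⊗ p.2;
  hopf_sub_antipode : forall a, A a -> A (antipode a)
}.

Definition central (B : hopfAlgType k) (A : B -> Prop) : Prop :=
  forall a b, A a -> a * b = b * a.

(* The ideal B A^+, where A^+ is the intersection of A with ker counit. *)
Definition augmentation_ideal (B : hopfAlgType k) (A : B -> Prop) (b : B) : Prop :=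
  exists s : seq (B * B),
    (forall p, p \in s -> A p.2 /\ counit p.2 = 0) /\
    b = \sum_(p <- s) p.1 * p.2.

Record hopf_morphism (B H : hopfAlgType k) (pi : {lrmorphism B -> H}) : Prop := {
  hopf_comul : forall b,
    comul (pi b) = \sum_(p <- sweedler b) pi p.1 ⊗ pi p.2;
  hopf_counit : forall b, counit (pi b) = counit b;
  hopf_antipode : forall b, pi (antipode b) = antipode (pi b)
}.

(* pi induces the isomorphism between B / B A^+ and H. *)
Record central_extension (B H : hopfAlgType k) (A : B -> Prop)
    (pi : {lrmorphism B -> H}) : Prop := {
  central_ext_sub : hopf_subalgebra A;
  central_ext_central : central A;
  central_ext_morphism : hopf_morphism pi;
  central_ext_surj : forall h, exists b, pi b = h;
  central_ext_ker : forall b, pi b = 0 <-> augmentation_ideal A b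
}.

Definition liftable (B H : hopfAlgType k) (pi : {lrmorphism B -> H})
    (V : lmodType k) (T : {linear H -> End V}) : Prop :=
  exists (X : {lrmorphism B -> End V}) (gamma : {linear B -> k^o}),
    [/\ conv_invertible gamma, gamma 1 = 1 &
        forall b, X b = \sum_(p <- sweedler b) (gamma p.1 : k) *: T (pi p.2)].
End CentralExtensions.

(* Main.v *)
Require Import Defs.
From HB Require Import structures.
From mathcomp Require Import all_boot all_order all_algebra.
From mathcomp Require Import boolp classical_sets.
Set Implicit Arguments.
Unset Strict Implicit.
Unset Printing Implicit Defensive.
Import GRing.Theory.
Local Open Scope ring_scope.

(** Write rep, coc and inv for three families of generators, rep(h) for h in H
and coc(c), inv(c) for c in H ⊗ H, each linear in its argument.  The extension
B is the algebra that they generate subject to: rep(1) = 1; every coc(c) and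
inv(c) is central; coc and inv are inverse to each other for convolution;
rep(x) rep(y) = coc(x_1 ⊗ y_1) rep(x_2 y_2); and coc is lazy.  A projective
representation T afforded by a lazy cocycle alpha satisfies these relations
with rep = T, coc = alpha and inv = alpha^-1, so it induces an algebra map
X : B -> End(V).  For a group this is the classical construction of Schur: the
central subgroup has one generator for each pair of group elements, and every
2-cocycle is one of its characters.

B is a Hopf algebra.  Its structure maps come from the universal property, by
exhibiting data that satisfy the relations (a value of type [twisted]) in
another algebra.  The coproduct sends rep(h) to rep(h_1) ⊗ rep(h_2), and this
respects the product rule because a lazy coc can be moved past any function of
the product ([tens_mul]).  The antipode sends rep to its convolution inverse
and exchanges coc with inv, with values in the opposite algebra.  That rep is
invertible follows from the relations: evaluating rep(xy), rewritten by means
of inv, at S(h_1) ⊗ h_2 gives a left inverse, and at h_1 ⊗ S(h_2), using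
laziness once more, a right inverse ([tw_rep_linv], [tw_rep_rinv]).

B is a central extension.  A is the subalgebra generated by the coc(c) and
inv(c).  Modulo B A^+ the map coc is trivial, hence rep is multiplicative and
b = rep(pi(b)) for all b ([aug_section]); so the kernel of pi is B A^+.

X has the form gamma * (T o pi).  The functional gamma depends on alpha only.
It is obtained from the regular projective representation of H on itself,
h.x = alpha(h_1 ⊗ x_1) h_2 x_2, where the cocycle identity is what makes it a
projective representation ([twmulA]).  If Xreg : B -> End(H) is the algebra map
that it induces, then gamma(b) = counit(Xreg(b) 1).  Two identities hold on the
generators and are stable under products, hence hold on B:
comul(Xreg(b) x) = Xreg(b_1) x_1 ⊗ pi(b_2) x_2 ([Xreg_comodule]) and
X(b) T(x) = T(Xreg(b) x) ([lift_intertwine]).  Taking x = 1 in both gives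
X(b) = gamma(b_1) T(pi(b_2)).  Finally gamma is the convolution product of Xreg
with the inverse of the regular representation pulled back along pi, and both
factors are invertible.

Two devices keep the calculations short.  An equality in B means equality after
evaluation in every algebra carrying such data, so that laziness, an identity
in R ⊗ H, has to be expressed inside R; this is done with linear functionals of
H, which separate the elements of R ⊗ H ([slice_inj]).  And most Sweedler
calculations take place in the convolution monoids of linear maps from a
coalgebra to an algebra, with pullback along coalgebra maps and pushforward
along algebra maps. *)

(** * Linear functionals and separation of tensors *)

Section Functionals.
Variables (k : fieldType) (V : lmodType k).

Definition subspace (M : V -> Prop) :=
  M 0 /\ forall (a : k) x y, M x -> M y -> M (a *: x + y).

Lemma subspaceZ M a x : subspace M -> M x -> M (a *: x).
Proof. by move=> [M0 ML] Mx; rewrite -[_ *: _]addr0; apply: ML. Qed.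

Lemma subspaceB M x y : subspace M -> M x -> M y -> M (x - y).
Proof. by move=> [M0 ML] Mx My; rewrite addrC -scaleN1r; apply: ML. Qed.

(** Zorn's lemma is applied to the sets N for which M0 union N is a subspace
without v, so that the empty chain needs no separate treatment. *)
Lemma maximal_avoiding (M0 : V -> Prop) v : subspace M0 -> ~ M0 v ->
  exists M : V -> Prop, [/\ subspace M, (forall x, M0 x -> M x), ~ M v &
    forall N : V -> Prop, subspace N -> (forall x, M x -> N x) -> ~ N v ->
      forall x, N x -> M x].
Proof.
move=> sM0 nM0v.
pose P (N : set V) := subspace (fun x => M0 x \/ N x) /\ ~ N v.
have [F FP totF|N [[sN nNv] Nmax]] := @Zorn_bigcup V P.
  split; last by move=> [X FX Xv]; case: (FP _ FX).
  split; first by left; case: sM0.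
  move=> a x y [Mx|[X FX Xx]] [My|[Y FY Yy]].
  - by left; apply: sM0.2.
  - have [sY _] := FP _ FY.
    have [|My'] := sY.2 a x y (or_introl Mx) (or_intror Yy); first by left.
    by right; exists Y.
  - have [sX _] := FP _ FX.
    have [|My'] := sX.2 a x y (or_intror Xx) (or_introl My); first by left.
    by right; exists X.
  - have [XY|YX] := totF _ _ FX FY.
      have [sY _] := FP _ FY.
      have [|My'] := sY.2 a x y (or_intror (XY _ Xx)) (or_intror Yy); first by left.
      by right; exists Y.
    have [sX _] := FP _ FX.
    have [|My'] := sX.2 a x y (or_intror Xx) (or_intror (YX _ Yy)); first by left.
    by right; exists X.
exists (fun x => M0 x \/ N x); split=> //; first by left.
  by case.
move=> Q sQ NQ nQv x Qx; apply: contrapT => nx; apply: (Nmax Q); last first.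
  split=> //; have -> // : (fun x => M0 x \/ Q x) = Q.
  by apply/funext => y; apply/propext; split=> [[My|//]|]; [apply: NQ; left | right].
split; first by move=> y Ny; apply: NQ; right.
by move=> QN; apply: nx; right; apply: QN.
Qed.

(** A maximal subspace M containing M0 but not v has codimension one: every x is
congruent to exactly one multiple of v, and f(x) is the coefficient. *)
Lemma separating_functional (M0 : V -> Prop) v : subspace M0 -> ~ M0 v ->
  exists f : {linear V -> k^o}, (forall x, M0 x -> f x = 0) /\ f v = 1.
Proof.
move=> sM0 nM0v; have [M [sM M0M nMv Mmax]] := maximal_avoiding sM0 nM0v.
have uniq x a b : M (x - a *: v) -> M (x - b *: v) -> a = b.
  move=> Ma Mb; apply: contrapT => ab; apply: nMv.
  have /eqP ab' : b - a <> 0 by move=> /eqP; rewrite subr_eq0 => /eqP/esym.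
  have := subspaceZ (b - a)^-1 sM (subspaceB sM Ma Mb).
  by rewrite opprB [_ - _ + _]addrC addrA subrK -scalerBl scalerA mulVf // scale1r.
have ex x : {a : k | M (x - a *: v)}.
  apply: cid; have [Mx|nMx] := pselect (M x).
    by exists 0; rewrite scale0r subr0.
  pose N y := exists a : k, M (y - a *: x).
  have sN : subspace N.
    split; first by exists 0; rewrite scale0r subr0; case: sM.
    move=> a y z [b My] [c Mz]; exists (a * b + c).
    by rewrite scalerDl opprD addrACA -scalerA -scalerBr; apply: sM.2.
  have MN y : M y -> N y by exists 0; rewrite scale0r subr0.
  (* N is M + k x; by maximality of M it contains v unless x is in M. *)
  have [[a Ma]|nNv] := pselect (N v); last first.
    case: nMx; apply: (Mmax N) => //; exists 1.
    by rewrite scale1r subrr; case: sM.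
  have a0 : a != 0.
    by apply/eqP => a0; rewrite a0 scale0r subr0 in Ma.
  exists a^-1; have := subspaceZ (- a^-1) sM Ma.
  by rewrite scalerBr !scaleNr scalerA mulVf // scale1r opprK addrC.
pose f x : k^o := sval (ex x).
have fP x : M (x - f x *: v) by rewrite /f; case: (ex x).
have fL : linear f.
  move=> a x y; apply: (uniq (a *: x + y)) => //.
  have -> : a *: x + y - (a *: f x + f y : k^o) *: v
     = a *: (x - f x *: v) + (y - f y *: v).
    by rewrite scalerDl opprD addrACA -scalerA -scalerBr.
  exact: sM.2.
have M0' : M 0 by case: sM.
pose fl := HB.pack_for {linear V -> k^o} f (GRing.isLinear.Build _ _ _ _ f fL).
exists fl; split=> [x Mx|].
  by apply: (uniq x) (fP x) _; rewrite scale0r subr0; apply: M0M.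
by apply: (uniq v) (fP v) _; rewrite scale1r subrr.
Qed.
End Functionals.

Section Separation.
Variables (k : fieldType) (U V : lmodType k).
Implicit Types t : tensor U V.

Fact slice_bilinear (f : {linear V -> k^o}) :
  is_bilinear (fun (u : U) v => (f v : k) *: u).
Proof.
split=> [v a u u'|u a v v'] /=; first by rewrite scalerDr !scalerA mulrC.
by rewrite linearP /= scalerDl -scalerA.
Qed.

(** The map id ⊗ f, with U ⊗ k identified with U. *)
Definition slice (f : {linear V -> k^o}) : tensor U V -> U :=
  tensor_lift (slice_bilinear f).
HB.instance Definition _ f := GRing.Linear.on (slice f).

(** The span of the second components. *)
Fixpoint span (s : seq (U * V)) (v : V) : Prop :=
  if s is p :: s' then exists a : k, span s' (v - a *: p.2) else v = 0.

Fact span_subspace s : subspace (span s).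
Proof.
elim: s => [|p s [s0 sL]] /=; first by split=> // a _ _ -> ->; rewrite scaler0 addr0.
split; first by exists 0; rewrite scale0r subr0.
move=> a x y [b sx] [c sy]; exists (a * b + c).
by rewrite scalerDl opprD addrACA -scalerA -scalerBr; apply: sL.
Qed.

(** The bilinear map is quantified after s' because the new list has to serve
both for the pure tensors and for the slices. *)
Lemma span_absorb s v u : span s v -> exists2 s', size s' = size s &
  forall (W : lmodType k) (b : U -> V -> W), is_bilinear b ->
    b u v + \sum_(p <- s) b p.1 p.2 = \sum_(p <- s') b p.1 p.2.
Proof.
elim: s v => [|p s IH] v /=.
  by move=> ->; exists [::] => // W b bP; rewrite (bilin0r bP) add0r.
case=> a /IH[s' s'n s'P]; exists ((a *: u + p.1, p.2) :: s') => [/=|W b bP].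
  by rewrite s'n.
rewrite !big_cons -s'P //= (bilinDl bP) (bilinZl bP) -(bilinZr bP) addrACA.
by rewrite addrA -(bilinDr bP) [_ *: _ + _]addrC subrK addrA.
Qed.

Lemma span_annihilated s (f : {linear V -> k^o}) :
  (forall v, span s v -> f v = 0) -> \sum_(p <- s) (f p.2 : k) *: p.1 = 0.
Proof.
elim: s => [|p s IH] f0; first by rewrite big_nil.
rewrite big_cons f0 /=; last first.
  by exists 1; rewrite scale1r subrr; case: (span_subspace s).
by rewrite scale0r add0r IH // => v sv; apply: f0; exists 0; rewrite scale0r subr0.
Qed.

(** Induction on the number of terms of t.  If the first right-hand factor lies
in the span of the others, its term is absorbed by them; otherwise a functional
that vanishes on the others shows that its left-hand factor is 0. *)
Lemma slice_eq0 t : (forall f, slice f t = 0) -> t = 0.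
Proof.
have key n : forall s : seq (U * V), size s = n ->
    (forall f : {linear V -> k^o}, \sum_(p <- s) (f p.2 : k) *: p.1 = 0) ->
    \sum_(p <- s) p.1 ⊗ p.2 = 0.
  elim: n => [[|//] _ _|n IH [//|[u v] s] [sn] s0]; first by rewrite big_nil.
  have [/(span_absorb u)[s' s'n s'P]|nv] := pselect (span s v).
    rewrite big_cons (s'P _ _ (tens_bilinear U V)); apply: IH; first by rewrite s'n.
    by move=> f; rewrite -[LHS](s'P _ _ (slice_bilinear f)) -[RHS](s0 f) big_cons.
  have [f [f0 f1]] := separating_functional (span_subspace s) nv.
  have u0 : u = 0.
    by have := s0 f; rewrite big_cons /= f1 scale1r span_annihilated ?addr0.
  rewrite big_cons u0 (bilin0l (tens_bilinear U V)) add0r; apply: IH => // g.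
  by have := s0 g; rewrite big_cons /= u0 scaler0 add0r.
by move=> h; rewrite (tensor_repr t); apply: (key (size (repr t))).
Qed.

Lemma slice_inj t t' : (forall f, slice f t = slice f t') -> t = t'.
Proof.
move=> h; apply/eqP; rewrite -subr_eq0; apply/eqP/slice_eq0 => f.
by rewrite linearB /= h subrr.
Qed.
End Separation.

(** * Convolution of linear maps *)

(** Algebras in which 1 = 0 is allowed and whose multiplication is part of the
data: endomorphism algebras of the zero space, tensor products and opposite
algebras all occur as targets of evaluation. *)
Record unitalAlgebra (k : fieldType) := UnitalAlgebra {
  ua_sort :> lmodType k;
  ua_one : ua_sort;
  ua_mul : ua_sort -> ua_sort -> ua_sort;
  ua_bilin : is_bilinear ua_mul;
  ua_mulA : associative ua_mul;
  ua_mul1l : left_id ua_one ua_mul;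
  ua_mul1r : right_id ua_one ua_mul
}.
Notation "x ⋅ y" := (ua_mul x y) (at level 40, left associativity) : ring_scope.
Arguments ua_one {k}.

Lemma linear_eq (k : fieldType) (U V : lmodType k) (f g : {linear U -> V}) :
  f =1 g -> f = g.
Proof.
case: f g => [f [[fD] [fZ]]] [g [[gD] [gZ]]] /funext /= E; subst g.
by rewrite (Prop_irrelevance fD gD) (Prop_irrelevance fZ gZ).
Qed.

Section UnitalAlgebraTheory.
Variables (k : fieldType) (R : unitalAlgebra k).
Implicit Types x y z : R.

Lemma ua_mulDl x y z : (x + y) ⋅ z = x ⋅ z + y ⋅ z.
Proof. exact: (bilinDl (@ua_bilin k R)). Qed.
Lemma ua_mulDr x y z : x ⋅ (y + z) = x ⋅ y + x ⋅ z.
Proof. exact: (bilinDr (@ua_bilin k R)). Qed.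
Lemma ua_mulZl (a : k) x y : (a *: x) ⋅ y = a *: (x ⋅ y).
Proof. exact: (bilinZl (@ua_bilin k R)). Qed.
Lemma ua_mulZr (a : k) x y : x ⋅ (a *: y) = a *: (x ⋅ y).
Proof. exact: (bilinZr (@ua_bilin k R)). Qed.
Lemma ua_suml (I : Type) (s : seq I) (F : I -> R) y :
  (\sum_(i <- s) F i) ⋅ y = \sum_(i <- s) F i ⋅ y.
Proof. exact: (bilin_suml (@ua_bilin k R)). Qed.
Lemma ua_sumr (I : Type) (s : seq I) x (F : I -> R) :
  x ⋅ (\sum_(i <- s) F i) = \sum_(i <- s) x ⋅ F i.
Proof. exact: (bilin_sumr (@ua_bilin k R)). Qed.
Lemma ua_mul0l x : 0 ⋅ x = 0 :> R.
Proof. exact: (bilin0l (@ua_bilin k R)). Qed.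
Lemma ua_mul0r x : x ⋅ 0 = 0 :> R.
Proof. exact: (bilin0r (@ua_bilin k R)). Qed.
Definition ua_mulE := (ua_mulDl, ua_mulDr, ua_mulZl, ua_mulZr).
End UnitalAlgebraTheory.

Section UnitalAlgebraExamples.
Variable k : fieldType.

Fact alg_of_bilin (A : algType k) : is_bilinear (fun x y : A => x * y).
Proof.
split=> [v a x y|v a x y] /=; first by rewrite mulrDl scalerAl.
by rewrite mulrDr scalerAr.
Qed.
Definition alg_of (A : algType k) : unitalAlgebra k :=
  UnitalAlgebra (alg_of_bilin A) (@mulrA A) (@mul1r A) (@mulr1 A).

Definition tensor_alg (A B : algType k) : unitalAlgebra k :=
  UnitalAlgebra (tmul_bilinear A B) (@tmulA k A B) (@tmul1l k A B) (@tmul1r k A B).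

Fact End_bilin (V : lmodType k) : is_bilinear (fun f g : End V => f * g).
Proof.
split=> [v a x y|v a x y] /=; first by rewrite mulrDl End_scalerAl.
by rewrite mulrDr End_scalerAr.
Qed.
Definition End_alg (V : lmodType k) : unitalAlgebra k :=
  UnitalAlgebra (End_bilin V) (@mulrA (End V)) (@mul1r (End V)) (@mulr1 (End V)).

Variable R : unitalAlgebra k.
Fact op_bilin : is_bilinear (fun x y : R => y ⋅ x).
Proof. by split=> v; [apply: (@ua_bilin k R).2 | apply: (@ua_bilin k R).1]. Qed.
Fact op_mulA : associative (fun x y : R => y ⋅ x).
Proof. by move=> x y z; rewrite ua_mulA. Qed.
Definition op_alg : unitalAlgebra k :=
  UnitalAlgebra op_bilin op_mulA (@ua_mul1r k R) (@ua_mul1l k R).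
End UnitalAlgebraExamples.

Record alghom (k : fieldType) (R R' : unitalAlgebra k) := AlgHom {
  ah_fun :> {linear R -> R'};
  ah_one : ah_fun (ua_one R) = ua_one R';
  ah_mul : forall x y, ah_fun (x ⋅ y) = ah_fun x ⋅ ah_fun y
}.

Record coalghom (k : fieldType) (D C : coalgType k) := CoalgHom {
  ch_fun :> {linear D -> C};
  ch_comul : forall d,
    comul (ch_fun d) = \sum_(p <- sweedler d) ch_fun p.1 ⊗ ch_fun p.2;
  ch_counit : forall d, counit (ch_fun d) = counit d
}.

Lemma sweedler_sum (k : fieldType) (C : coalgType k) (W : lmodType k)
    (b : C -> C -> W) c : \sum_(p <- sweedler c) b p.1 p.2 = tensor_sum b (comul c).
Proof. by []. Qed.

Lemma sweedler_coalghom (k : fieldType) (D C : coalgType k) (W : lmodType k)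
    (phi : coalghom D C) (b : C -> C -> W) d : is_bilinear b ->
  \sum_(p <- sweedler (phi d)) b p.1 p.2
  = \sum_(p <- sweedler d) b (phi p.1) (phi p.2).
Proof.
move=> bP; rewrite sweedler_sum ch_comul tensor_sum_sum //.
by apply: eq_bigr => p _; rewrite tensor_sumE.
Qed.

Section Convolution.
Variables (k : fieldType) (C : coalgType k).

Section Fixed.
Variable R : unitalAlgebra k.
Implicit Types f g h : {linear C -> R}.

Fact conv_bilin f g : is_bilinear (fun x y : C => f x ⋅ g y).
Proof. by split=> v a x y; rewrite /= linearP !ua_mulE. Qed.

Definition conv_fun f g (c : C) : R := \sum_(p <- sweedler c) f p.1 ⋅ g p.2.
Fact conv_linear f g : linear (conv_fun f g).
Proof. exact: (sweedler_linear (conv_bilin f g)). Qed.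
HB.instance Definition _ f g :=
  GRing.isLinear.Build k C R *:%R (conv_fun f g) (conv_linear f g).
Definition conv f g : {linear C -> R} := conv_fun f g.

Definition scal_fun (f : {linear C -> k^o}) (c : C) : R := (f c : k) *: ua_one R.
Fact scal_linear (f : {linear C -> k^o}) : linear (scal_fun f).
Proof. by move=> a x y; rewrite /scal_fun linearP scalerDl -scalerA. Qed.
HB.instance Definition _ (f : {linear C -> k^o}) :=
  GRing.isLinear.Build k C R *:%R (scal_fun f) (scal_linear f).
Definition scal (f : {linear C -> k^o}) : {linear C -> R} := scal_fun f.
Definition cunit : {linear C -> R} := scal counit.
End Fixed.
End Convolution.

Arguments cunit {k C R}.
Arguments scal {k C R} f.
Infix "⋆" := conv (at level 40, left associativity) : ring_scope.

Section ConvolutionTheory.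
Variables (k : fieldType) (C : coalgType k) (R : unitalAlgebra k).
Implicit Types f g h : {linear C -> R}.

Lemma convE f g c : (f ⋆ g) c = \sum_(p <- sweedler c) f p.1 ⋅ g p.2.
Proof. by []. Qed.
Lemma scalE (f : {linear C -> k^o}) c :
  (scal f : {linear C -> R}) c = (f c : k) *: ua_one R.
Proof. by []. Qed.
Lemma cunitE c : (cunit : {linear C -> R}) c = (counit c : k) *: ua_one R.
Proof. by []. Qed.

Lemma convA f g h : f ⋆ (g ⋆ h) = f ⋆ g ⋆ h.
Proof.
apply: linear_eq => c; rewrite !convE.
under eq_bigr => p _ do rewrite convE ua_sumr.
under [RHS]eq_bigr => p _ do rewrite convE ua_suml.
pose F x y z := f x ⋅ g y ⋅ h z.
rewrite [RHS](sweedler_coassoc (F := F)) => [|y z a x x'|x]; last first.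
- by split=> v a y z; rewrite /F /= linearP !ua_mulE.
- by rewrite /F linearP !ua_mulE.
by apply: eq_bigr => p _; apply: eq_bigr => q _; rewrite ua_mulA.
Qed.

Lemma conv_scall (f : {linear C -> k^o}) g c :
  (scal f ⋆ g) c = \sum_(p <- sweedler c) (f p.1 : k) *: g p.2.
Proof. by apply: eq_bigr => p _; rewrite scalE ua_mulZl ua_mul1l. Qed.

Lemma conv_scalr (f : {linear C -> k^o}) g c :
  (g ⋆ scal f) c = \sum_(p <- sweedler c) (f p.2 : k) *: g p.1.
Proof. by apply: eq_bigr => p _; rewrite scalE ua_mulZr ua_mul1r. Qed.

Lemma conv1f f : cunit ⋆ f = f.
Proof.
apply: linear_eq => c; rewrite conv_scall -[in RHS](comul_counitl c) linear_sum.
by apply: eq_bigr => p _; rewrite linearZ.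
Qed.

Lemma convf1 f : f ⋆ cunit = f.
Proof.
apply: linear_eq => c; rewrite conv_scalr -[in RHS](comul_counitr c) linear_sum.
by apply: eq_bigr => p _; rewrite linearZ.
Qed.

Lemma conv_inv_uniq f g h : f ⋆ g = cunit -> g ⋆ h = cunit -> f = h.
Proof. by move=> fg gh; rewrite -[f]convf1 -gh convA fg conv1f. Qed.

(** An inverse commutes with whatever the element commutes with; this transfers
laziness from a cocycle to its inverse. *)
Lemma conv_inv_commute f g h :
  f ⋆ g = cunit -> g ⋆ f = cunit -> f ⋆ h = h ⋆ f -> g ⋆ h = h ⋆ g.
Proof.
move=> fg gf fh; rewrite -[LHS]convf1 -fg convA -[g ⋆ h ⋆ f]convA -fh.
by rewrite convA gf conv1f.
Qed.

End ConvolutionTheory.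

Section PullPush.
Variable k : fieldType.

Section Pull.
Variables (D C : coalgType k) (R : unitalAlgebra k).
Variable phi : coalghom D C.
Implicit Types f g : {linear C -> R}.

Definition pull f : {linear D -> R} := f \o phi.
Lemma pullE f d : pull f d = f (phi d). Proof. by []. Qed.
Lemma pull_conv f g : pull (f ⋆ g) = pull f ⋆ pull g.
Proof.
by apply: linear_eq => d; rewrite pullE !convE (sweedler_coalghom _ _ (conv_bilin f g)).
Qed.
Lemma pull_unit : pull cunit = cunit.
Proof. by apply: linear_eq => d; rewrite pullE !cunitE ch_counit. Qed.
End Pull.

Section Push.
Variables (C : coalgType k) (R R' : unitalAlgebra k) (a : alghom R R').
Implicit Types f g : {linear C -> R}.
Definition push f : {linear C -> R'} := a \o f.
Lemma pushE f d : push f d = a (f d). Proof. by []. Qed.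
Lemma push_conv f g : push (f ⋆ g) = push f ⋆ push g.
Proof.
apply: linear_eq => d; rewrite pushE !convE linear_sum.
by apply: eq_bigr => p _; rewrite ah_mul.
Qed.
Lemma push_scal (f : {linear C -> k^o}) : push (scal f) = scal f.
Proof. by apply: linear_eq => d; rewrite pushE !scalE linearZ /= ah_one. Qed.
Lemma push_unit : push cunit = cunit.
Proof. exact: push_scal. Qed.
End Push.
End PullPush.

Definition mk_linear (k : fieldType) (U V : lmodType k) (f : U -> V)
    (fL : linear f) : {linear U -> V} :=
  HB.pack_for {linear U -> V} f (GRing.isLinear.Build k U V *:%R f fL).

(** * Tensor products of coalgebras and of algebras *)

Section TensorBasics.
Variable k : fieldType.

Lemma tensDl (U V : lmodType k) (v : V) : linear (fun u : U => u ⊗ v).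
Proof. exact: (tens_bilinear U V).1. Qed.
Lemma tensDr (U V : lmodType k) (u : U) : linear (fun v : V => u ⊗ v).
Proof. exact: (tens_bilinear U V).2. Qed.

Lemma tensor_eq (U V W : lmodType k) (f g : {linear tensor U V -> W}) :
  (forall u v, f (u ⊗ v) = g (u ⊗ v)) -> f = g.
Proof.
move=> fg; apply: linear_eq; apply: linear_ext_tensor => // a x y;
  by rewrite linearP.
Qed.
End TensorBasics.

Section CounitSums.
Variables (k : fieldType) (C : coalgType k).

Lemma counit_sum1 (W : lmodType k) (f : {linear C -> W}) c :
  \sum_(p <- sweedler c) (counit p.1 : k) *: f p.2 = f c.
Proof.
rewrite -[in RHS](comul_counitl c) linear_sum.
by apply: eq_bigr => p _; rewrite linearZ.
Qed.

Lemma counit_sum2 (W : lmodType k) (f : {linear C -> W}) c :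
  \sum_(p <- sweedler c) (counit p.2 : k) *: f p.1 = f c.
Proof.
rewrite -[in RHS](comul_counitr c) linear_sum.
by apply: eq_bigr => p _; rewrite linearZ.
Qed.

Lemma counit_counit (W : lmodType k) (w : W) (c : C) :
  \sum_(p <- sweedler c) (counit p.1 * counit p.2 : k) *: w = (counit c : k) *: w.
Proof. by rewrite -scaler_suml (counit_sum1 (W := k^o) counit). Qed.
End CounitSums.

Section TensorCoalgebraMaps.
Variables (k : fieldType) (C D : coalgType k).

Lemma sweedler_tens (W : lmodType k) (G : tensor C D -> tensor C D -> W) c d :
  is_bilinear G ->
  \sum_(p <- sweedler (c ⊗ d)) G p.1 p.2
  = \sum_(q <- sweedler c) \sum_(r <- sweedler d) G (q.1 ⊗ r.1) (q.2 ⊗ r.2).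
Proof. exact: tcomul_sum. Qed.

Lemma conv_tens (R : unitalAlgebra k) (f g : {linear tensor C D -> R}) c d :
  (f ⋆ g) (c ⊗ d) = \sum_(q <- sweedler c) \sum_(r <- sweedler d)
    f (q.1 ⊗ r.1) ⋅ g (q.2 ⊗ r.2).
Proof. by rewrite convE (sweedler_tens _ _ (conv_bilin f g)). Qed.

(** Both sides are linear in t, so comultiplicativity is checked on pure
tensors, where the coproduct of the source is explicit. *)
Lemma tensor_comul_eq (E : coalgType k) (f : {linear tensor C D -> E}) :
  (forall c d, comul (f (c ⊗ d)) = \sum_(q <- sweedler c) \sum_(r <- sweedler d)
     f (q.1 ⊗ r.1) ⊗ f (q.2 ⊗ r.2)) ->
  forall t, comul (f t) = \sum_(p <- sweedler t) f p.1 ⊗ f p.2.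
Proof.
move=> fE; have bP : is_bilinear (fun x y => f x ⊗ f y).
  by split=> v a x y; rewrite /= linearP ?tensDl ?tensDr.
apply: linear_ext_tensor => [a x y||c d]; first by rewrite !linearP.
  exact: (sweedler_linear bP).
by rewrite fE (sweedler_tens _ _ bP).
Qed.

Lemma tensor_counit_eq (E : coalgType k) (f : {linear tensor C D -> E}) :
  (forall c d, counit (f (c ⊗ d)) = (counit c * counit d : k)) ->
  forall t, counit (f t) = counit t.
Proof.
move=> fE; apply: linear_ext_tensor => [a x y|a x y|c d]; rewrite ?linearP //.
by rewrite fE; exact: esym (tcounitE c d).
Qed.

Fact tproj1_bilin : is_bilinear (fun (c : C) (d : D) => (counit d : k) *: c).
Proof. exact: slice_bilinear. Qed.
Fact tproj2_bilin : is_bilinear (fun (c : C) (d : D) => (counit c : k) *: d).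
Proof.
split=> v a x y /=; first by rewrite linearP /= scalerDl -scalerA.
by rewrite scalerDr !scalerA mulrC.
Qed.
Definition tproj1_lin : {linear tensor C D -> C} := tensor_lift tproj1_bilin.
Definition tproj2_lin : {linear tensor C D -> D} := tensor_lift tproj2_bilin.

Lemma tproj1_linE c d : tproj1_lin (c ⊗ d) = (counit d : k) *: c.
Proof. exact: tensor_liftE. Qed.
Lemma tproj2_linE c d : tproj2_lin (c ⊗ d) = (counit c : k) *: d.
Proof. exact: tensor_liftE. Qed.

Fact tproj1_comul t :
  comul (tproj1_lin t) = \sum_(p <- sweedler t) tproj1_lin p.1 ⊗ tproj1_lin p.2.
Proof.
move: t; apply: tensor_comul_eq => c d; rewrite tproj1_linE linearZ /=.
rewrite [comul c](tensor_repr (comul c)) scaler_sumr; apply: eq_bigr => p _.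
rewrite -counit_counit; apply: eq_bigr => r _.
rewrite !tproj1_linE (bilinZl (tens_bilinear C C)) (bilinZr (tens_bilinear C C)).
by rewrite scalerA.
Qed.

Fact tproj2_comul t :
  comul (tproj2_lin t) = \sum_(p <- sweedler t) tproj2_lin p.1 ⊗ tproj2_lin p.2.
Proof.
move: t; apply: tensor_comul_eq => c d; rewrite tproj2_linE linearZ /= exchange_big.
rewrite [comul d](tensor_repr (comul d)) scaler_sumr; apply: eq_bigr => p _.
rewrite -counit_counit; apply: eq_bigr => r _.
rewrite !tproj2_linE (bilinZl (tens_bilinear D D)) (bilinZr (tens_bilinear D D)).
by rewrite scalerA.
Qed.

Fact tproj1_counit t : counit (tproj1_lin t) = counit t.
Proof.
by move: t; apply: tensor_counit_eq => c d; rewrite tproj1_linE linearZ /= mulrC.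
Qed.
Fact tproj2_counit t : counit (tproj2_lin t) = counit t.
Proof. by move: t; apply: tensor_counit_eq => c d; rewrite tproj2_linE linearZ. Qed.

Definition tproj1 : coalghom (tensor C D) C := CoalgHom tproj1_comul tproj1_counit.
Definition tproj2 : coalghom (tensor C D) D := CoalgHom tproj2_comul tproj2_counit.

Section Products.
Variable R : unitalAlgebra k.
Implicit Types (f : {linear C -> R}) (g : {linear D -> R}).

(** A product of two factors with independent arguments is a convolution of
pullbacks along the projections of H ⊗ H; this brings rep(x) rep(y) into the
convolution monoid. *)
Lemma conv_proj12 f g c d :
  (pull tproj1 f ⋆ pull tproj2 g) (c ⊗ d) = f c ⋅ g d.
Proof.
rewrite conv_tens -[in RHS](counit_sum2 f c) -[in RHS](counit_sum1 g d) ua_suml.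
apply: eq_bigr => q _; rewrite ua_sumr; apply: eq_bigr => r _.
rewrite !pullE /= tproj1_linE tproj2_linE !linearZ !ua_mulE.
by rewrite !scalerA mulrC.
Qed.

Lemma conv_proj21 f g c d :
  (pull tproj2 g ⋆ pull tproj1 f) (c ⊗ d) = g d ⋅ f c.
Proof.
rewrite conv_tens exchange_big -[in RHS](counit_sum1 f c).
rewrite -[in RHS](counit_sum2 g d) ua_suml.
apply: eq_bigr => q _; rewrite ua_sumr; apply: eq_bigr => r _.
rewrite !pullE /= tproj1_linE tproj2_linE !linearZ !ua_mulE.
by rewrite !scalerA mulrC.
Qed.

Lemma conv_proj_commute f g : (forall c d, f c ⋅ g d = g d ⋅ f c) ->
  pull tproj1 f ⋆ pull tproj2 g = pull tproj2 g ⋆ pull tproj1 f.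
Proof. by move=> fg; apply: tensor_eq => c d; rewrite conv_proj12 conv_proj21. Qed.
End Products.
End TensorCoalgebraMaps.

Section TensorAlgebraMaps.
Variable k : fieldType.

Section Inclusions.
Variables A B : algType k.
Local Notation AB := (tensor_alg A B).

Fact tincl1_mul (x y : alg_of A) :
  mk_linear (tensDl (1 : B)) (x ⋅ y)
  = (mk_linear (tensDl 1) x : AB) ⋅ mk_linear (tensDl 1) y.
Proof. by rewrite /= tmulE mulr1. Qed.
Definition tincl1 : alghom (alg_of A) AB :=
  @AlgHom k (alg_of A) AB (mk_linear (tensDl (1 : B))) erefl tincl1_mul.

Fact tincl2_mul (x y : alg_of B) :
  mk_linear (tensDr (1 : A)) (x ⋅ y)
  = (mk_linear (tensDr 1) x : AB) ⋅ mk_linear (tensDr 1) y.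
Proof. by rewrite /= tmulE mulr1. Qed.
Definition tincl2 : alghom (alg_of B) AB :=
  @AlgHom k (alg_of B) AB (mk_linear (tensDr (1 : A))) erefl tincl2_mul.

Lemma tincl12 x y : tincl1 x ⋅ tincl2 y = x ⊗ y :> AB.
Proof. by rewrite /= tmulE mulr1 mul1r. Qed.
Lemma tincl21 x y : tincl2 y ⋅ tincl1 x = x ⊗ y :> AB.
Proof. by rewrite /= tmulE mulr1 mul1r. Qed.
Lemma tincl_commute x y : tincl1 x ⋅ tincl2 y = tincl2 y ⋅ tincl1 x :> AB.
Proof. by rewrite tincl12 tincl21. Qed.

Lemma conv_tincl (C : coalgType k) (f : {linear C -> alg_of A})
    (g : {linear C -> alg_of B}) c :
  (push tincl1 f ⋆ push tincl2 g) c
  = \sum_(p <- sweedler c) f p.1 ⊗ g p.2 :> tensor A B.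
Proof. by apply: eq_bigr => p _; exact: tincl12. Qed.

Lemma conv_tincl_rev (C : coalgType k) (f : {linear C -> alg_of A})
    (g : {linear C -> alg_of B}) c :
  (push tincl2 g ⋆ push tincl1 f) c
  = \sum_(p <- sweedler c) f p.2 ⊗ g p.1 :> tensor A B.
Proof. by apply: eq_bigr => p _; exact: tincl21. Qed.

Section Pairing.
Variables (R : unitalAlgebra k) (f : alghom (alg_of A) R) (g : alghom (alg_of B) R).
Hypothesis fg : forall x y, f x ⋅ g y = g y ⋅ f x.

Fact tpair_bilin : is_bilinear (fun (x : A) (y : B) => f x ⋅ g y).
Proof. by split=> v a x y; rewrite /= linearP !ua_mulE. Qed.
Definition tpair_lin : {linear tensor A B -> R} := tensor_lift tpair_bilin.
Lemma tpair_linE x y : tpair_lin (x ⊗ y) = f x ⋅ g y.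
Proof. exact: tensor_liftE. Qed.
Fact tpair_one : tpair_lin (ua_one AB) = ua_one R.
Proof. by rewrite tpair_linE (ah_one f) (ah_one g) ua_mul1l. Qed.
Fact tpair_mul (x y : AB) : tpair_lin (x ⋅ y) = tpair_lin x ⋅ tpair_lin y.
Proof.
elim/tensor_ind: x => [|x x' IH IH'|a b]; first by rewrite ua_mul0l linear0 ua_mul0l.
  by rewrite ua_mulDl !linearD IH IH' ua_mulDl.
elim/tensor_ind: y => [|x x' IH IH'|c d]; first by rewrite ua_mul0r linear0 ua_mul0r.
  by rewrite ua_mulDr !linearD IH IH' ua_mulDr.
rewrite /= tmulE !tpair_linE (ah_mul f a c) (ah_mul g b d).
by rewrite -!ua_mulA; congr (_ ⋅ _); rewrite !ua_mulA fg.
Qed.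
(** The universal property of A ⊗ B as an algebra. *)
Definition tpair : alghom AB R := @AlgHom k AB R tpair_lin tpair_one tpair_mul.

Lemma tpairE t : tpair t = \sum_(p <- repr t) f p.1 ⋅ g p.2.
Proof. by []. Qed.

Lemma push_tpair_incl1 (C : coalgType k) (u : {linear C -> alg_of A}) :
  push tpair (push tincl1 u) = push f u.
Proof.
by apply: linear_eq => c; rewrite !pushE [LHS]tpair_linE (ah_one g) ua_mul1r.
Qed.
Lemma push_tpair_incl2 (C : coalgType k) (u : {linear C -> alg_of B}) :
  push tpair (push tincl2 u) = push g u.
Proof.
by apply: linear_eq => c; rewrite !pushE [LHS]tpair_linE (ah_one f) ua_mul1l.
Qed.
End Pairing.
End Inclusions.
End TensorAlgebraMaps.

(** * Antipodes *)

Section HopfBasics.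
Variables (k : fieldType) (H : hopfAlgType k).

Lemma comul1 : comul (1 : H) = 1 ⊗ 1.
Proof. exact: (@comul_monoid_morphism k H).1. Qed.
Lemma comulM (x y : H) : comul (x * y) = comul x * comul y.
Proof. exact: (@comul_monoid_morphism k H).2. Qed.
Lemma counit1 : counit (1 : H) = 1 :> k.
Proof. exact: (@counit_monoid_morphism k H).1. Qed.
Lemma counitM (x y : H) : counit (x * y) = counit x * counit y :> k.
Proof. exact: (@counit_monoid_morphism k H).2. Qed.

Lemma sweedler1 (W : lmodType k) (b : H -> H -> W) : is_bilinear b ->
  \sum_(p <- sweedler 1) b p.1 p.2 = b 1 1.
Proof. by move=> bP; rewrite sweedler_sum comul1 tensor_sumE. Qed.

Definition comul_hom : alghom (alg_of H) (tensor_alg H H) :=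
  @AlgHom k (alg_of H) (tensor_alg H H) comul comul1 comulM.
Definition counit_hom : alghom (alg_of H) (alg_of k^o) :=
  @AlgHom k (alg_of H) (alg_of k^o) counit counit1 counitM.

Definition mul_lin : {linear tensor H H -> H} := tensor_lift (alg_of_bilin H).
Lemma mul_linE x y : mul_lin (x ⊗ y) = x * y.
Proof. exact: tensor_liftE. Qed.
Fact mul_comul t : comul (mul_lin t) = \sum_(p <- sweedler t) mul_lin p.1 ⊗ mul_lin p.2.
Proof.
move: t; apply: tensor_comul_eq => x y; rewrite mul_linE comulM.
rewrite [comul x](tensor_repr (comul x)) [comul y](tensor_repr (comul y)).
rewrite mulr_suml; apply: eq_bigr => p _; rewrite mulr_sumr.
by apply: eq_bigr => q _; rewrite !mul_linE; exact: tmulE.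
Qed.
Fact mul_counit t : counit (mul_lin t) = counit t.
Proof. by move: t; apply: tensor_counit_eq => x y; rewrite mul_linE counitM. Qed.
Definition mulc : coalghom (tensor H H) H := CoalgHom mul_comul mul_counit.
Lemma mulcE x y : mulc (x ⊗ y) = x * y. Proof. exact: mul_linE. Qed.

Definition id_lin : {linear H -> alg_of H} :=
  mk_linear (f := fun x : H => x : alg_of H) (fun a x y => erefl).
Definition antipode_lin : {linear H -> alg_of H} := antipode.

Lemma antipode_convl : antipode_lin ⋆ id_lin = cunit.
Proof. by apply: linear_eq => h; apply: antipodel. Qed.
Lemma antipode_convr : id_lin ⋆ antipode_lin = cunit.
Proof. by apply: linear_eq => h; apply: antipoder. Qed.

(** Both sides are convolution inverse to the coproduct, as maps from H to
H ⊗ H. *)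
Lemma antipode_comul h : comul (antipode h) =
  \sum_(p <- sweedler h) antipode p.2 ⊗ antipode p.1 :> tensor H H.
Proof.
rewrite -(conv_tincl_rev antipode_lin antipode_lin).
suff /(congr1 (fun f : {linear _ -> _} => f h)) <- :
  push comul_hom antipode_lin
    = push (tincl2 H H) antipode_lin ⋆ push (tincl1 H H) antipode_lin by [].
apply: (@conv_inv_uniq _ _ _ _ (push comul_hom id_lin)).
  by rewrite -push_conv antipode_convl push_unit.
have -> : push comul_hom id_lin = push (tincl1 H H) id_lin ⋆ push (tincl2 H H) id_lin.
  apply: linear_eq => x; rewrite conv_tincl; exact: tensor_repr.
rewrite convA -[_ ⋆ push (tincl2 H H) antipode_lin]convA -push_conv antipode_convr.
by rewrite push_unit convf1 -push_conv antipode_convr push_unit.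
Qed.

Lemma sweedler_antipode (W : lmodType k) (b : H -> H -> W) h : is_bilinear b ->
  \sum_(p <- sweedler (antipode h)) b p.1 p.2
  = \sum_(p <- sweedler h) b (antipode p.2) (antipode p.1).
Proof.
move=> bP; rewrite sweedler_sum antipode_comul tensor_sum_sum //.
by apply: eq_bigr => p _; rewrite tensor_sumE.
Qed.
End HopfBasics.

(** * Projective data and invertibility *)

(** The two ways of reading h_1, h_2, h_3, h_4: splitting both factors of the
coproduct, or splitting the second factor and then its first part. *)
Lemma sweedler4 (k : fieldType) (C : coalgType k) (W : lmodType k)
    (G : C -> C -> C -> C -> W) c :
  (forall y z w, linear (fun x => G x y z w)) ->
  (forall x z w, linear (fun y => G x y z w)) ->
  (forall x y w, linear (fun z => G x y z w)) ->
  (forall x y z, linear (G x y z)) ->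
  \sum_(p <- sweedler c) \sum_(q <- sweedler p.1) \sum_(r <- sweedler p.2)
     G q.1 q.2 r.1 r.2
  = \sum_(p <- sweedler c) \sum_(q <- sweedler p.2) \sum_(r <- sweedler q.1)
     G p.1 r.1 r.2 q.2.
Proof.
move=> G1 G2 G3 G4; pose F x y z := \sum_(r <- sweedler z) G x y r.1 r.2.
have GP x y : is_bilinear (G x y) by split=> v; [apply: G3 | apply: G4].
have F3 x y : linear (F x y) by apply: sweedler_linear.
rewrite (sweedler_coassoc (F := F)) => [|y z|x]; last first.
- by split=> [z|y //]; apply: linear_sum_fun => r; apply: G2.
- by apply: linear_sum_fun => r; apply: G1.
apply: eq_bigr => p _; rewrite [RHS](sweedler_coassoc (F := G p.1)) //.
Qed.

Section Lazy.
Variables (k : fieldType) (H : hopfAlgType k) (R : unitalAlgebra k).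
Local Notation C := (tensor H H).
Local Notation mulc := (mulc H).

(** The hypothesis says that the slices of s(c_1) ⊗ m(c_2) and s(c_2) ⊗ m(c_1)
agree.  The tensors are then equal, and the bilinear map (r, h) |-> r g(h) can
be applied to them. *)
Lemma lazy_commute (s : {linear C -> R}) (g : {linear H -> R}) :
  (forall f : {linear H -> k^o},
     s ⋆ pull mulc (scal f) = pull mulc (scal f) ⋆ s) ->
  (forall c h, s c ⋅ g h = g h ⋅ s c) ->
  s ⋆ pull mulc g = pull mulc g ⋆ s.
Proof.
move=> sf sg; apply: linear_eq => c.
have bP : is_bilinear (fun (r : R) (h : H) => r ⋅ g h).
  by split=> v a x y; rewrite /= ?linearP !ua_mulE.
suff E : \sum_(p <- sweedler c) s p.1 ⊗ (mulc p.2)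
       = \sum_(p <- sweedler c) s p.2 ⊗ (mulc p.1) :> tensor R H.
  have := congr1 (tensor_sum (fun (r : R) (h : H) => r ⋅ g h)) E.
  rewrite !tensor_sum_sum // => E'.
  transitivity (\sum_(p <- sweedler c) s p.1 ⋅ g (mulc p.2)) => //.
  transitivity (\sum_(p <- sweedler c) s p.2 ⋅ g (mulc p.1)); last first.
    by apply: eq_bigr => p _; rewrite sg.
  by move: E'; under eq_bigr => p _ do rewrite tensor_sumE //;
     under [X in _ = X -> _]eq_bigr => p _ do rewrite tensor_sumE //.
apply: slice_inj => f.
have /(congr1 (fun u : {linear _ -> _} => u c)) := sf f.
rewrite !convE !linear_sum => E.
transitivity (\sum_(p <- sweedler c) s p.1 ⋅ (pull mulc (scal f) : {linear C -> R}) p.2).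
  apply: eq_bigr => p _; rewrite [LHS]tensor_liftE // pullE scalE.
  by rewrite ua_mulZr ua_mul1r.
rewrite E; apply: eq_bigr => p _; rewrite [RHS]tensor_liftE // pullE scalE.
by rewrite ua_mulZl ua_mul1l.
Qed.
End Lazy.

(** The data of the universal problem: a projective representation of H in R
whose cocycle takes values in the centre of R instead of the base field. *)
Record twisted (k : fieldType) (H : hopfAlgType k) (R : unitalAlgebra k) := Twisted {
  tw_rep : {linear H -> R};
  tw_coc : {linear tensor H H -> R};
  tw_inv : {linear tensor H H -> R};
  tw_one : tw_rep 1 = ua_one R;
  tw_coc_central : forall c r, tw_coc c ⋅ r = r ⋅ tw_coc c;
  tw_inv_central : forall c r, tw_inv c ⋅ r = r ⋅ tw_inv c;
  tw_convr : tw_coc ⋆ tw_inv = cunit;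
  tw_convl : tw_inv ⋆ tw_coc = cunit;
  tw_mul : pull (tproj1 H H) tw_rep ⋆ pull (tproj2 H H) tw_rep
           = tw_coc ⋆ pull (mulc H) tw_rep;
  tw_lazy : forall f : {linear H -> k^o},
    tw_coc ⋆ pull (mulc H) (scal f) = pull (mulc H) (scal f) ⋆ tw_coc
}.

Section TwistedTheory.
Variables (k : fieldType) (H : hopfAlgType k) (R : unitalAlgebra k).
Variable d : twisted H R.
Local Notation g := (tw_rep d).
Local Notation s := (tw_coc d).
Local Notation t := (tw_inv d).
Local Notation p1 := (tproj1 H H).
Local Notation p2 := (tproj2 H H).
Local Notation m := (mulc H).
Local Notation S := (antipode : H -> H).

Lemma tw_lazy_rep (u : {linear H -> R}) : s ⋆ pull m u = pull m u ⋆ s.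
Proof. by apply: lazy_commute => [|c h]; [apply: tw_lazy | apply: tw_coc_central]. Qed.

Lemma tw_lazy_inv (u : {linear H -> R}) : t ⋆ pull m u = pull m u ⋆ t.
Proof. exact: conv_inv_commute (tw_convr d) (tw_convl d) (tw_lazy_rep u). Qed.

Lemma tw_mulE x y : g x ⋅ g y = (s ⋆ pull m g) (x ⊗ y).
Proof. by rewrite -tw_mul conv_proj12. Qed.

Lemma tw_mul_invl : t ⋆ (pull p1 g ⋆ pull p2 g) = pull m g.
Proof. by rewrite tw_mul convA tw_convl conv1f. Qed.

Lemma tw_mul_invr : pull p1 g ⋆ pull p2 g ⋆ t = pull m g.
Proof. by rewrite tw_mul tw_lazy_rep -convA tw_convr convf1. Qed.

Definition repS : {linear H -> R} := g \o S.

Fact corr_bilinl : is_bilinear (fun x y : H => t (S x ⊗ y)).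
Proof. by split=> v a x y; rewrite /= ?linearP ?tensDl ?tensDr ?linearP. Qed.
Fact corr_bilinr : is_bilinear (fun x y : H => t (x ⊗ S y)).
Proof. by split=> v a x y; rewrite /= ?linearP ?tensDl ?tensDr ?linearP. Qed.
Definition corrl : {linear H -> R} := mk_linear (sweedler_linear corr_bilinl).
Definition corrr : {linear H -> R} := mk_linear (sweedler_linear corr_bilinr).

Lemma corrlE h : corrl h = \sum_(p <- sweedler h) t (S p.1 ⊗ p.2).
Proof. by []. Qed.
Lemma corrrE h : corrr h = \sum_(p <- sweedler h) t (p.1 ⊗ S p.2).
Proof. by []. Qed.

(** Evaluate rep(xy) = inv(x_1 ⊗ y_1) rep(x_2) rep(y_2) at S(h_1) ⊗ h_2.  The
left-hand side is counit(h).  Since S reverses the coproduct, the right-hand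
side is inv(S(h_2) ⊗ h_3) rep(S(h_1)) rep(h_4), and inv is central. *)
Lemma tw_rep_linv : repS ⋆ corrl ⋆ g = cunit.
Proof.
apply: linear_eq => h; rewrite -convA cunitE.
pose G x y z w := g (S x) ⋅ t (S y ⊗ z) ⋅ g w.
transitivity (\sum_(p <- sweedler h)
    (t ⋆ (pull p1 g ⋆ pull p2 g)) (S p.1 ⊗ p.2)); last first.
  rewrite tw_mul_invl; under eq_bigr => p _ do rewrite pullE mulcE.
  by rewrite -linear_sum antipodel linearZ /= tw_one.
transitivity (\sum_(p <- sweedler h) \sum_(q <- sweedler p.1) \sum_(r <- sweedler p.2)
     G q.1 q.2 r.1 r.2); last first.
  apply: eq_bigr => p _; rewrite conv_tens.
  pose b x y := \sum_(r <- sweedler p.2)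
    t (x ⊗ r.1) ⋅ (pull p1 g ⋆ pull p2 g) (y ⊗ r.2).
  have bP : is_bilinear b.
    by apply: bilinear_sum => r; split=> v a x y; rewrite /= !tensDl linearP !ua_mulE.
  rewrite [RHS](sweedler_antipode p.1 bP).
  apply: eq_bigr => q _; apply: eq_bigr => r _.
  by rewrite /G conv_proj12 ua_mulA tw_inv_central.
rewrite sweedler4; first last.
- by move=> x y z a w w'; rewrite /G linearP !ua_mulE.
- by move=> x y w a z z'; rewrite /G tensDr linearP !ua_mulE.
- by move=> x z w a y y'; rewrite /G linearP tensDl linearP !ua_mulE.
- by move=> y z w a x x'; rewrite /G !linearP !ua_mulE.
rewrite convE; apply: eq_bigr => p _; rewrite convE ua_sumr; apply: eq_bigr => q _.
rewrite corrlE ua_suml ua_sumr; apply: eq_bigr => r _.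
by rewrite /G ua_mulA.
Qed.

(** The same at h_1 ⊗ S(h_2) for rep(xy) = rep(x_1) rep(y_1) inv(x_2 ⊗ y_2),
the form of the product rule which laziness provides: one obtains
rep(h_1) rep(S(h_4)) inv(h_2 ⊗ S(h_3)), where the factors after the first
depend on h_2, h_3, h_4 only. *)
Lemma tw_rep_rinv : g ⋆ (corrr ⋆ repS) = cunit.
Proof.
apply: linear_eq => h; rewrite cunitE.
pose G x y z w := g x ⋅ t (y ⊗ S z) ⋅ g (S w).
transitivity (\sum_(p <- sweedler h)
    (pull p1 g ⋆ pull p2 g ⋆ t) (p.1 ⊗ S p.2)); last first.
  rewrite tw_mul_invr; under eq_bigr => p _ do rewrite pullE mulcE.
  by rewrite -linear_sum antipoder linearZ /= tw_one.
transitivity (\sum_(p <- sweedler h) \sum_(q <- sweedler p.1) \sum_(r <- sweedler p.2)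
     G q.1 q.2 r.1 r.2); last first.
  apply: eq_bigr => p _; rewrite conv_tens; apply: eq_bigr => q _.
  have bP : is_bilinear (fun x y =>
      (pull p1 g ⋆ pull p2 g) (q.1 ⊗ x) ⋅ t (q.2 ⊗ y)).
    by split=> v a x y; rewrite /= !tensDr linearP !ua_mulE.
  rewrite [RHS](sweedler_antipode p.2 bP).
  apply: eq_bigr => r _.
  by rewrite /G conv_proj12 -!ua_mulA tw_inv_central.
rewrite sweedler4; first last.
- by move=> x y z a w w'; rewrite /G !linearP !ua_mulE.
- by move=> x y w a z z'; rewrite /G linearP tensDr linearP !ua_mulE.
- by move=> x z w a y y'; rewrite /G tensDl linearP !ua_mulE.
- by move=> y z w a x x'; rewrite /G !linearP !ua_mulE.
rewrite convE; apply: eq_bigr => p _; rewrite convE ua_sumr; apply: eq_bigr => q _.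
rewrite corrrE ua_suml ua_sumr; apply: eq_bigr => r _.
by rewrite /G ua_mulA.
Qed.

Definition tw_dual : {linear H -> R} := repS ⋆ corrl.

Lemma tw_dual_convl : tw_dual ⋆ g = cunit.
Proof. exact: tw_rep_linv. Qed.

Lemma tw_dual_convr : g ⋆ tw_dual = cunit.
Proof. by rewrite [tw_dual](conv_inv_uniq tw_rep_linv tw_rep_rinv) tw_rep_rinv. Qed.

Lemma tw_dual_one : tw_dual 1 = ua_one R.
Proof.
have /(congr1 (fun u : {linear _ -> _} => u 1)) := tw_dual_convl.
rewrite convE (sweedler1 (conv_bilin tw_dual g)) tw_one ua_mul1r => ->.
by rewrite cunitE counit1 scale1r.
Qed.

(** Both sides are inverse to rep(x) rep(y); laziness puts inv on the left. *)
Lemma tw_dual_mul : pull p2 tw_dual ⋆ pull p1 tw_dual = t ⋆ pull m tw_dual.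
Proof.
apply: (@conv_inv_uniq _ _ _ _ (pull p1 g ⋆ pull p2 g)).
  rewrite convA -[X in X ⋆ _ = _]convA -pull_conv tw_dual_convl pull_unit convf1.
  by rewrite -pull_conv tw_dual_convl pull_unit.
rewrite tw_mul tw_lazy_rep -convA [s ⋆ _]convA tw_convr conv1f.
by rewrite -pull_conv tw_dual_convr pull_unit.
Qed.
End TwistedTheory.

(** * Constructions of projective data *)

Section TwistedExamples.
Variables (k : fieldType) (H : hopfAlgType k).
Local Notation p1 := (tproj1 H H).
Local Notation p2 := (tproj2 H H).
Local Notation m := (mulc H).

Lemma scal_central (C : coalgType k) (R : unitalAlgebra k) (f : {linear C -> k^o}) c r :
  (scal f : {linear C -> R}) c ⋅ r = r ⋅ (scal f : {linear C -> R}) c.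
Proof. by rewrite scalE ua_mulZl ua_mulZr ua_mul1l ua_mul1r. Qed.

Section Scalar.
Variables (R : unitalAlgebra k) (T : {linear H -> R}).
Variables alpha beta : {linear tensor H H -> k^o}.
Hypothesis T1 : T 1 = ua_one R.
Hypothesis ab : forall c, convolution alpha beta c = counit c.
Hypothesis ba : forall c, convolution beta alpha c = counit c.
Hypothesis TM : forall x y, T x ⋅ T y =
  \sum_(p <- sweedler x) \sum_(q <- sweedler y)
    (alpha (p.1 ⊗ q.1) : k) *: T (p.2 * q.2).
Hypothesis al : lazy alpha.

Lemma scal_conv (f g : {linear tensor H H -> k^o}) :
  (forall c, convolution f g c = counit c) ->
  scal f ⋆ scal g = cunit :> {linear _ -> R}.
Proof.
move=> fg; apply: linear_eq => c; rewrite conv_scall cunitE -fg scaler_suml.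
by apply: eq_bigr => p _; rewrite scalE scalerA.
Qed.

Fact scal_twisted_mul : pull p1 T ⋆ pull p2 T = scal alpha ⋆ pull m T.
Proof.
apply: tensor_eq => x y; rewrite conv_proj12 TM conv_tens.
apply: eq_bigr => p _; apply: eq_bigr => q _.
by rewrite scalE ua_mulZl ua_mul1l pullE mulcE.
Qed.

Fact scal_twisted_lazy (f : {linear H -> k^o}) :
  scal alpha ⋆ pull m (scal f) = pull m (scal f) ⋆ scal alpha :> {linear _ -> R}.
Proof.
apply: tensor_eq => x y; rewrite !conv_tens.
have /(congr1 f) := al x y; rewrite !linear_sum => E.
have {}E : \sum_(p <- sweedler x) \sum_(q <- sweedler y)
    (alpha (p.1 ⊗ q.1) * f (p.2 * q.2) : k) =
  \sum_(p <- sweedler x) \sum_(q <- sweedler y)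
    (alpha (p.2 ⊗ q.2) * f (p.1 * q.1) : k).
  move: E; under eq_bigr => p _ do
    (rewrite linear_sum; under eq_bigr => q _ do rewrite linearZ /=).
  by under [in RHS]eq_bigr => p _ do
    (rewrite linear_sum; under eq_bigr => q _ do rewrite linearZ /=).
move/(congr1 (fun a : k => a *: ua_one R)): E; rewrite !scaler_suml => E.
transitivity (\sum_(p <- sweedler x) (\sum_(q <- sweedler y)
    (alpha (p.1 ⊗ q.1) * f (p.2 * q.2) : k)) *: ua_one R).
  apply: eq_bigr => p _; rewrite scaler_suml; apply: eq_bigr => q _.
  by rewrite pullE !scalE ua_mulZl ua_mul1l mulcE scalerA.
rewrite E; apply: eq_bigr => p _; rewrite scaler_suml; apply: eq_bigr => q _.
by rewrite pullE !scalE ua_mulZr ua_mul1r mulcE scalerA.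
Qed.

Definition scal_twisted : twisted H R :=
  Twisted T1 (scal_central alpha) (scal_central beta)
    (scal_conv ab) (scal_conv ba) scal_twisted_mul scal_twisted_lazy.
End Scalar.

Section Hom.
Variables (R : unitalAlgebra k) (phi : alghom (alg_of H) R).
Fact hom_twisted_mul :
  pull p1 phi ⋆ pull p2 phi = cunit ⋆ pull m phi :> {linear _ -> R}.
Proof.
by apply: tensor_eq => x y; rewrite conv_proj12 conv1f pullE mulcE (ah_mul phi x y).
Qed.
Fact hom_twisted_lazy (f : {linear H -> k^o}) :
  cunit ⋆ pull m (scal f) = pull m (scal f) ⋆ cunit :> {linear _ -> R}.
Proof. by rewrite conv1f convf1. Qed.
Definition hom_twisted : twisted H R :=
  Twisted (ah_one phi) (scal_central counit) (scal_central counit)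
    (conv1f cunit) (conv1f cunit) hom_twisted_mul hom_twisted_lazy.
End Hom.

(** The data that define the antipode: rep is replaced by its inverse and coc is
exchanged with inv, because a product of inverses comes in reverse order. *)
Section Op.
Variables (R : unitalAlgebra k) (d : twisted H R).
Local Notation s := (tw_coc d).
Local Notation t := (tw_inv d).
Local Notation RO := (op_alg R).
Let s' : {linear tensor H H -> RO} := s.
Let t' : {linear tensor H H -> RO} := t.
Let d' : {linear H -> RO} := tw_dual d.

Fact op_central_conv (f g : {linear tensor H H -> R}) c :
  (forall c r, f c ⋅ r = r ⋅ f c) ->
  ((f : {linear tensor H H -> RO}) ⋆ (g : {linear tensor H H -> RO})) c
  = (f ⋆ g) c :> R.
Proof. by move=> fC; apply: eq_bigr => p _ /=; rewrite fC. Qed.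

Fact op_twisted_convr : t' ⋆ s' = cunit.
Proof.
apply: linear_eq => c; rewrite [LHS](op_central_conv s _ (@tw_inv_central _ _ _ d)).
by rewrite tw_convl.
Qed.
Fact op_twisted_convl : s' ⋆ t' = cunit.
Proof.
apply: linear_eq => c; rewrite [LHS](op_central_conv t _ (@tw_coc_central _ _ _ d)).
by rewrite tw_convr.
Qed.
Fact op_twisted_mul : pull p1 d' ⋆ pull p2 d' = t' ⋆ pull m d'.
Proof.
apply: tensor_eq => x y; rewrite conv_proj12.
rewrite [RHS](op_central_conv (pull m (tw_dual d)) _ (@tw_inv_central _ _ _ d)).
by rewrite -tw_dual_mul conv_proj21.
Qed.
Fact op_twisted_lazy (f : {linear H -> k^o}) :
  t' ⋆ pull m (scal f) = pull m (scal f) ⋆ t'.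
Proof.
apply: linear_eq => c.
rewrite [LHS](op_central_conv (pull m (scal f)) _ (@tw_inv_central _ _ _ d)).
rewrite [RHS](op_central_conv t (f := pull m (scal f))) ?tw_lazy_inv // => c' r.
exact: scal_central.
Qed.
Definition op_twisted : twisted H RO :=
  @Twisted k H RO d' t' s' (tw_dual_one d)
    (fun c r => esym (tw_inv_central d c r)) (fun c r => esym (tw_coc_central d c r))
    op_twisted_convr op_twisted_convl op_twisted_mul op_twisted_lazy.
End Op.

(** The data that define the coproduct.  The factors of inv are in reverse order,
as for the inverse of a product. *)
Section Tensor.
Variables (A B : algType k) (d : twisted H (alg_of A)) (e : twisted H (alg_of B)).
Local Notation AB := (tensor_alg A B).
Local Notation i1 := (tincl1 A B).
Local Notation i2 := (tincl2 A B).

Definition tens_rep : {linear H -> AB} := push i1 (tw_rep d) ⋆ push i2 (tw_rep e).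
Definition tens_coc : {linear tensor H H -> AB} :=
  push i1 (tw_coc d) ⋆ push i2 (tw_coc e).
Definition tens_inv : {linear tensor H H -> AB} :=
  push i2 (tw_inv e) ⋆ push i1 (tw_inv d).

Lemma tens_central (a : A) (b : B) : (forall x, a * x = x * a) ->
  (forall y, b * y = y * b) -> forall r : AB, (a ⊗ b : AB) ⋅ r = r ⋅ (a ⊗ b).
Proof.
move=> aC bC; elim/tensor_ind => [|x y IH IH'|x y].
- by rewrite ua_mul0l ua_mul0r.
- by rewrite ua_mulDl ua_mulDr IH IH'.
- by rewrite /= !tmulE aC bC.
Qed.

Fact tens_one : tens_rep 1 = ua_one AB.
Proof.
have bP := conv_bilin (push i1 (tw_rep d)) (push i2 (tw_rep e)).
rewrite /tens_rep convE (sweedler1 bP) !pushE !tw_one.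
by rewrite (ah_one i1) (ah_one i2) ua_mul1l.
Qed.
Fact tens_coc_central c r : tens_coc c ⋅ r = r ⋅ tens_coc c.
Proof.
rewrite /tens_coc conv_tincl ua_suml ua_sumr; apply: eq_bigr => p _.
by apply: tens_central => x; [apply: (tw_coc_central d) | apply: (tw_coc_central e)].
Qed.
Fact tens_inv_central c r : tens_inv c ⋅ r = r ⋅ tens_inv c.
Proof.
rewrite /tens_inv conv_tincl_rev ua_suml ua_sumr; apply: eq_bigr => p _.
by apply: tens_central => x; [apply: (tw_inv_central d) | apply: (tw_inv_central e)].
Qed.
Fact tens_convr : tens_coc ⋆ tens_inv = cunit.
Proof.
rewrite /tens_coc /tens_inv convA -[X in X ⋆ _]convA -push_conv tw_convr push_unit convf1.
by rewrite -push_conv tw_convr push_unit.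
Qed.
Fact tens_convl : tens_inv ⋆ tens_coc = cunit.
Proof.
rewrite /tens_coc /tens_inv convA -[X in X ⋆ _]convA -push_conv tw_convl push_unit convf1.
by rewrite -push_conv tw_convl push_unit.
Qed.
Lemma pull_push (C D : coalgType k) (R R' : unitalAlgebra k) (phi : coalghom D C)
  (a : alghom R R') (f : {linear C -> R}) : pull phi (push a f) = push a (pull phi f).
Proof. exact: linear_eq. Qed.

Fact tens_mul : pull p1 tens_rep ⋆ pull p2 tens_rep = tens_coc ⋆ pull m tens_rep.
Proof.
(* The two factors of coc and rep sit in different tensor factors and hence
   commute as values, so laziness applies across the tensor product. *)
have lazy12 : push i2 (tw_coc e) ⋆ pull m (push i1 (tw_rep d))
            = pull m (push i1 (tw_rep d)) ⋆ push i2 (tw_coc e).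
  apply: lazy_commute => [f|c h]; last by rewrite !pushE tincl_commute.
  by rewrite -(push_scal i2) pull_push -!push_conv tw_lazy.
have proj12 : pull p1 (push i2 (tw_rep e)) ⋆ pull p2 (push i1 (tw_rep d))
            = pull p2 (push i1 (tw_rep d)) ⋆ pull p1 (push i2 (tw_rep e)).
  by apply: conv_proj_commute => x y; rewrite !pushE tincl_commute.
rewrite /tens_rep /tens_coc !pull_conv -[LHS]convA [X in _ ⋆ X]convA proj12.
rewrite -[X in _ ⋆ X]convA convA !pull_push -!push_conv !tw_mul !push_conv -!pull_push.
by rewrite -!convA; congr (_ ⋆ _); rewrite !convA lazy12.
Qed.

Fact tens_lazy (f : {linear H -> k^o}) :
  tens_coc ⋆ pull m (scal f) = pull m (scal f) ⋆ tens_coc.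
Proof.
rewrite /tens_coc -convA -{1}(push_scal i2) pull_push -push_conv tw_lazy push_conv.
rewrite -pull_push push_scal -(push_scal i1) pull_push convA -push_conv tw_lazy.
by rewrite push_conv convA.
Qed.

Definition tens_twisted : twisted H AB :=
  Twisted tens_one tens_coc_central tens_inv_central tens_convr tens_convl
    tens_mul tens_lazy.
End Tensor.
End TwistedExamples.

(** * The universal algebra *)

Section UniversalAlgebra.
Local Open Scope quotient_scope.
Variables (k : fieldType) (H : hopfAlgType k).

Inductive term : Type :=
| TRep of H | TCoc of tensor H H | TInv of tensor H H
| TZero | TOne | TAdd of term & term | TScale of k & term | TMul of term & term.
HB.instance Definition _ := gen_eqMixin term.
HB.instance Definition _ := gen_choiceMixin term.

Fixpoint eval (R : unitalAlgebra k) (d : twisted H R) (t : term) : R :=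
  match t with
  | TRep h => tw_rep d h
  | TCoc c => tw_coc d c
  | TInv c => tw_inv d c
  | TZero => 0
  | TOne => ua_one R
  | TAdd t u => eval d t + eval d u
  | TScale a t => a *: eval d t
  | TMul t u => eval d t ⋅ eval d u
  end.

(** Terms are identified when no algebra with projective data tells them apart;
every ring axiom then holds because it holds after evaluation. *)
Definition term_rel (t u : term) : bool :=
  `[< forall (R : unitalAlgebra k) (d : twisted H R), eval d t = eval d u >].
Fact term_rel_refl : reflexive term_rel.
Proof. by move=> t; apply/asboolP. Qed.
Fact term_rel_sym : symmetric term_rel.
Proof. by move=> t u; apply/asboolP/asboolP => h R d; rewrite h. Qed.
Fact term_rel_trans : transitive term_rel.
Proof.
move=> t u v /asboolP tu /asboolP uv; apply/asboolP => R d.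
by rewrite tu uv.
Qed.
Canonical term_equiv := EquivRel term_rel term_rel_refl term_rel_sym term_rel_trans.

Definition uext : Type := {eq_quot term_equiv}.
HB.instance Definition _ := Choice.on uext.
HB.instance Definition _ := EqQuotient.on uext.

Section Evaluation.
Variables (R : unitalAlgebra k) (d : twisted H R).
Definition ev (b : uext) : R := eval d (repr b).
Lemma ev_pi t : ev (\pi_uext t) = eval d t.
Proof. by have /eqquotP/asboolP := reprK (\pi_uext t); apply. Qed.
End Evaluation.

Lemma uext_eq (b c : uext) :
  (forall (R : unitalAlgebra k) (d : twisted H R), ev d b = ev d c) -> b = c.
Proof. by move=> bc; rewrite -[b]reprK -[c]reprK; apply/eqquotP/asboolP. Qed.

Definition uext_add (b c : uext) : uext := \pi_uext (TAdd (repr b) (repr c)).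
Definition uext_scale (a : k) (b : uext) : uext := \pi_uext (TScale a (repr b)).
Definition uext_opp (b : uext) : uext := uext_scale (-1) b.
Definition uext_mul (b c : uext) : uext := \pi_uext (TMul (repr b) (repr c)).
Definition uext_zero : uext := \pi_uext TZero.
Definition uext_one : uext := \pi_uext TOne.

Section EvaluationOps.
Variables (R : unitalAlgebra k) (d : twisted H R).
Lemma ev_add b c : ev d (uext_add b c) = ev d b + ev d c. Proof. exact: ev_pi. Qed.
Lemma ev_scale a b : ev d (uext_scale a b) = a *: ev d b. Proof. exact: ev_pi. Qed.
Lemma ev_opp b : ev d (uext_opp b) = - ev d b.
Proof. by rewrite ev_scale scaleN1r. Qed.
Lemma ev_mul b c : ev d (uext_mul b c) = ev d b ⋅ ev d c. Proof. exact: ev_pi. Qed.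
Lemma ev_zero : ev d uext_zero = 0. Proof. exact: ev_pi. Qed.
Lemma ev_one : ev d uext_one = ua_one R. Proof. exact: ev_pi. Qed.
Definition evE := (ev_add, ev_opp, ev_scale, ev_mul, ev_zero, ev_one).
End EvaluationOps.

Fact uext_addA : associative uext_add.
Proof. by move=> x y z; apply: uext_eq => R d; rewrite !evE addrA. Qed.
Fact uext_addC : commutative uext_add.
Proof. by move=> x y; apply: uext_eq => R d; rewrite !evE addrC. Qed.
Fact uext_add0 : left_id uext_zero uext_add.
Proof. by move=> x; apply: uext_eq => R d; rewrite !evE add0r. Qed.
Fact uext_addN : left_inverse uext_zero uext_opp uext_add.
Proof. by move=> x; apply: uext_eq => R d; rewrite !evE addNr. Qed.
HB.instance Definition _ := GRing.isZmodule.Build uext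
  uext_addA uext_addC uext_add0 uext_addN.

Fact uext_mulA : associative uext_mul.
Proof. by move=> x y z; apply: uext_eq => R d; rewrite !evE ua_mulA. Qed.
Fact uext_mul1l : left_id uext_one uext_mul.
Proof. by move=> x; apply: uext_eq => R d; rewrite !evE ua_mul1l. Qed.
Fact uext_mul1r : right_id uext_one uext_mul.
Proof. by move=> x; apply: uext_eq => R d; rewrite !evE ua_mul1r. Qed.
Fact uext_mulDl : left_distributive uext_mul uext_add.
Proof. by move=> x y z; apply: uext_eq => R d; rewrite !evE ua_mulDl. Qed.
Fact uext_mulDr : right_distributive uext_mul uext_add.
Proof. by move=> x y z; apply: uext_eq => R d; rewrite !evE ua_mulDr. Qed.
(** The counit of H is projective data in the field k, where 1 and 0 differ. *)
Fact uext_one_neq0 : uext_one != uext_zero.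
Proof.
apply/eqP => /(congr1 (ev (hom_twisted (counit_hom H)))) /eqP.
by rewrite !evE /= oner_eq0.
Qed.
HB.instance Definition _ := GRing.Zmodule_isNzRing.Build uext
  uext_mulA uext_mul1l uext_mul1r uext_mulDl uext_mulDr uext_one_neq0.

Fact uext_scaleA a b t : uext_scale a (uext_scale b t) = uext_scale (a * b) t.
Proof. by apply: uext_eq => R d; rewrite !evE scalerA. Qed.
Fact uext_scale1 : left_id 1 uext_scale.
Proof. by move=> x; apply: uext_eq => R d; rewrite !evE scale1r. Qed.
Fact uext_scaleDr : right_distributive uext_scale +%R.
Proof. by move=> a x y; apply: uext_eq => R d; rewrite !evE scalerDr. Qed.
Fact uext_scaleDl t : {morph uext_scale^~ t : a b / a + b}.
Proof. by move=> a c; apply: uext_eq => R d; rewrite !evE scalerDl. Qed.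
HB.instance Definition _ :=
  GRing.Zmodule_isLmodule.Build k uext uext_scaleA uext_scale1 uext_scaleDr uext_scaleDl.

Fact uext_scaleAl (a : k) (x y : uext) : a *: (x * y) = (a *: x) * y.
Proof. by apply: uext_eq => R d; rewrite !evE ua_mulZl. Qed.
Fact uext_scaleAr (a : k) (x y : uext) : a *: (x * y) = x * (a *: y).
Proof. by apply: uext_eq => R d; rewrite !evE ua_mulZr. Qed.
HB.instance Definition _ := GRing.Lmodule_isLalgebra.Build k uext uext_scaleAl.
HB.instance Definition _ := GRing.Lalgebra_isAlgebra.Build k uext uext_scaleAr.

Section UniversalMap.
Variables (R : unitalAlgebra k) (d : twisted H R).
Fact ev_linear : linear (ev d).
Proof. by move=> a x y; rewrite [LHS]ev_add ev_scale. Qed.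
Definition ev_hom : alghom (alg_of uext) R :=
  @AlgHom k (alg_of uext) R (mk_linear ev_linear) (ev_one d) (ev_mul d).
End UniversalMap.

Fact gen_rep_linear : linear (fun h => \pi_uext (TRep h)).
Proof.
move=> a x y; apply: uext_eq => R d.
by rewrite [RHS](ev_linear d) !ev_pi /= linearP.
Qed.
Fact gen_coc_linear : linear (fun c => \pi_uext (TCoc c)).
Proof.
move=> a x y; apply: uext_eq => R d.
by rewrite [RHS](ev_linear d) !ev_pi /= linearP.
Qed.
Fact gen_inv_linear : linear (fun c => \pi_uext (TInv c)).
Proof.
move=> a x y; apply: uext_eq => R d.
by rewrite [RHS](ev_linear d) !ev_pi /= linearP.
Qed.
Definition gen_rep : {linear H -> alg_of uext} := mk_linear gen_rep_linear.
Definition gen_coc : {linear tensor H H -> alg_of uext} := mk_linear gen_coc_linear.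
Definition gen_inv : {linear tensor H H -> alg_of uext} := mk_linear gen_inv_linear.

Section UniversalMapGens.
Variables (R : unitalAlgebra k) (d : twisted H R).
Lemma ev_rep h : ev_hom d (gen_rep h) = tw_rep d h. Proof. exact: ev_pi. Qed.
Lemma ev_coc h : ev_hom d (gen_coc h) = tw_coc d h. Proof. exact: ev_pi. Qed.
Lemma ev_inv h : ev_hom d (gen_inv h) = tw_inv d h. Proof. exact: ev_pi. Qed.
Lemma push_ev_rep : push (ev_hom d) gen_rep = tw_rep d.
Proof. by apply: linear_eq => h; apply: ev_rep. Qed.
Lemma push_ev_coc : push (ev_hom d) gen_coc = tw_coc d.
Proof. by apply: linear_eq => h; apply: ev_coc. Qed.
Lemma push_ev_inv : push (ev_hom d) gen_inv = tw_inv d.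
Proof. by apply: linear_eq => h; apply: ev_inv. Qed.
End UniversalMapGens.

Lemma push_ev_eq (C : coalgType k) (f g : {linear C -> alg_of uext}) :
  (forall R (d : twisted H R), push (ev_hom d) f = push (ev_hom d) g) -> f = g.
Proof.
move=> fg; apply: linear_eq => c; apply: uext_eq => R d.
exact: (congr1 (fun u : {linear _ -> _} => u c) (fg R d)).
Qed.

Fact gen_rep_one : gen_rep 1 = ua_one (alg_of uext).
Proof.
by apply: uext_eq => R d; rewrite [LHS]ev_rep tw_one; apply: esym (ev_one d).
Qed.
Fact gen_coc_central c r : gen_coc c ⋅ r = r ⋅ gen_coc c.
Proof.
apply: uext_eq => R d.
by rewrite [LHS]ev_mul [RHS]ev_mul [ev d (gen_coc c)]ev_coc tw_coc_central.
Qed.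
Fact gen_inv_central c r : gen_inv c ⋅ r = r ⋅ gen_inv c.
Proof.
apply: uext_eq => R d.
by rewrite [LHS]ev_mul [RHS]ev_mul [ev d (gen_inv c)]ev_inv tw_inv_central.
Qed.
Fact gen_convr : gen_coc ⋆ gen_inv = cunit.
Proof.
by apply: push_ev_eq => R d; rewrite push_conv push_ev_coc push_ev_inv push_unit tw_convr.
Qed.
Fact gen_convl : gen_inv ⋆ gen_coc = cunit.
Proof.
by apply: push_ev_eq => R d; rewrite push_conv push_ev_coc push_ev_inv push_unit tw_convl.
Qed.
Fact gen_rep_mul : pull (tproj1 H H) gen_rep ⋆ pull (tproj2 H H) gen_rep
  = gen_coc ⋆ pull (mulc H) gen_rep.
Proof.
apply: push_ev_eq => R d.
by rewrite !push_conv -!pull_push push_ev_coc push_ev_rep tw_mul.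
Qed.
Fact gen_lazy (f : {linear H -> k^o}) :
  gen_coc ⋆ pull (mulc H) (scal f) = pull (mulc H) (scal f) ⋆ gen_coc.
Proof.
apply: push_ev_eq => R d.
by rewrite !push_conv -!pull_push push_ev_coc push_scal tw_lazy.
Qed.
Definition uext_twisted : twisted H (alg_of uext) :=
  Twisted gen_rep_one gen_coc_central gen_inv_central gen_convr gen_convl
    gen_rep_mul gen_lazy.

Lemma uext_ind (P : uext -> Prop) :
  P 0 -> P 1 -> (forall b c, P b -> P c -> P (b + c)) ->
  (forall a b, P b -> P (a *: b)) -> (forall b c, P b -> P c -> P (b * c)) ->
  (forall h, P (gen_rep h)) -> (forall c, P (gen_coc c)) -> (forall c, P (gen_inv c)) ->
  forall b, P b.
Proof.
move=> P0 P1 PD PZ PM Pr Pc Pi b; rewrite -[b]reprK.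
elim: (repr b) => [h|c|c|||t IHt u IHu|a t IHt|t IHt u IHu];
  [exact: Pr | exact: Pc | exact: Pi | exact: P0 | exact: P1 | | | ].
- have -> // : \pi_uext (TAdd t u) = \pi_uext t + \pi_uext u; last exact: PD.
  by apply: uext_eq => R d; rewrite [RHS]ev_add !ev_pi.
- have -> // : \pi_uext (TScale a t) = a *: \pi_uext t; last exact: PZ.
  by apply: uext_eq => R d; rewrite [RHS]ev_scale !ev_pi.
- have -> // : \pi_uext (TMul t u) = \pi_uext t * \pi_uext u; last exact: PM.
  by apply: uext_eq => R d; rewrite [RHS]ev_mul !ev_pi.
Qed.

Lemma uext_hom_eq (R : unitalAlgebra k) (f g : alghom (alg_of uext) R) :
  push f gen_rep = push g gen_rep -> push f gen_coc = push g gen_coc ->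
  push f gen_inv = push g gen_inv -> f =1 g.
Proof.
move=> fr fc fi; elim/uext_ind => [||b c fb fc'|a b fb|b c fb fc'|h|c|c].
- by rewrite !linear0.
- by rewrite (ah_one f) (ah_one g).
- by rewrite !linearD fb fc'.
- by rewrite !linearZ fb.
- by rewrite (ah_mul f b c) (ah_mul g b c) fb fc'.
- exact: (congr1 (fun u : {linear _ -> _} => u h) fr).
- exact: (congr1 (fun u : {linear _ -> _} => u c) fc).
- exact: (congr1 (fun u : {linear _ -> _} => u c) fi).
Qed.
End UniversalAlgebra.

(** * The Hopf algebra structure *)

Definition ah_comp (k : fieldType) (R S T : unitalAlgebra k)
    (f : alghom S T) (g : alghom R S) : alghom R T :=
  @AlgHom k R T (f \o g : {linear R -> T})
    (etrans (congr1 f (ah_one g)) (ah_one f))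
    (fun x y => etrans (congr1 f (ah_mul g x y)) (ah_mul f (g x) (g y))).

Lemma push_comp (k : fieldType) (C : coalgType k) (R S T : unitalAlgebra k)
    (f : alghom S T) (g : alghom R S) (u : {linear C -> R}) :
  push (ah_comp f g) u = push f (push g u).
Proof. exact: linear_eq. Qed.

Section IdUnit.
Variables (k : fieldType) (R : unitalAlgebra k).
Definition ah_id : alghom R R :=
  @AlgHom k R R (idfun : {linear R -> R}) erefl (fun x y => erefl).
Fact unit_linear : linear (fun a : k^o => (a : k) *: ua_one R).
Proof. by move=> a x y; rewrite scalerDl -scalerA. Qed.
Fact unit_mul (x y : alg_of k^o) : mk_linear unit_linear (x ⋅ y)
  = mk_linear unit_linear x ⋅ mk_linear unit_linear y.
Proof. by rewrite /= ua_mulZl ua_mul1l scalerA. Qed.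
Definition unit_hom : alghom (alg_of k^o) R :=
  @AlgHom k (alg_of k^o) R (mk_linear unit_linear) (scale1r _) unit_mul.
Lemma unit_hom_central a x : unit_hom a ⋅ x = x ⋅ unit_hom a.
Proof. by rewrite /= ua_mulZl ua_mulZr ua_mul1l ua_mul1r. Qed.
Lemma push_id (C : coalgType k) (u : {linear C -> R}) : push ah_id u = u.
Proof. exact: linear_eq. Qed.
Lemma push_unit_hom (C : coalgType k) (u : {linear C -> k^o}) :
  push unit_hom (u : {linear C -> alg_of k^o}) = scal u.
Proof. exact: linear_eq. Qed.
End IdUnit.

Section UniversalHopfAlgebra.
Variables (k : fieldType) (H : hopfAlgType k).
Local Notation B := (uext H).
Local Notation BB := (tensor B B).
Local Notation u := (uext_twisted H).

Definition uext_comul : alghom (alg_of B) (tensor_alg B B) := ev_hom (tens_twisted u u).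
Definition uext_counit : alghom (alg_of B) (alg_of k^o) :=
  ev_hom (hom_twisted (counit_hom H)).

(** With this B ⊗ B becomes a nonzero algebra, so that B ⊗ (B ⊗ B), in which
coassociativity is stated, has an algebra structure. *)
Fact uext_tensor_neq0 : (1 : BB) != 0.
Proof.
apply/eqP => /(congr1 (tpair (f := uext_counit) (g := uext_counit) (fun x y => mulrC _ _))).
by rewrite linear0 [LHS](ah_one (tpair _)) => /eqP; rewrite oner_eq0.
Qed.
HB.instance Definition _ := GRing.PzSemiRing_isNonZero.Build BB uext_tensor_neq0.
HB.instance Definition _ := GRing.Lmodule_isLalgebra.Build k BB
  (fun a x y => esym (bilinZl (tmul_bilinear B B) a x y)).
HB.instance Definition _ := GRing.Lalgebra_isAlgebra.Build k BB
  (fun a x y => esym (bilinZr (tmul_bilinear B B) a x y)).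

Local Notation i1 := (tincl1 B B).
Local Notation i2 := (tincl2 B B).
Local Notation j1 := (tincl1 B BB).
(** The same multiplication on B ⊗ B, packaged in two ways. *)
Definition tensor_bridge : alghom (tensor_alg B B) (alg_of BB) :=
  @AlgHom k (tensor_alg B B) (alg_of BB) (idfun : {linear BB -> BB}) erefl
    (fun x y => erefl).
Local Notation j2 := (ah_comp (tincl2 B BB) tensor_bridge).

Lemma push_comul_rep :
  push uext_comul (gen_rep H) = push i1 (gen_rep H) ⋆ push i2 (gen_rep H).
Proof. exact: push_ev_rep. Qed.
Lemma push_comul_coc :
  push uext_comul (gen_coc H) = push i1 (gen_coc H) ⋆ push i2 (gen_coc H).
Proof. exact: push_ev_coc. Qed.
Lemma push_comul_inv :
  push uext_comul (gen_inv H) = push i2 (gen_inv H) ⋆ push i1 (gen_inv H).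
Proof. exact: push_ev_inv. Qed.
Lemma push_counit_rep : push uext_counit (gen_rep H) = counit.
Proof. exact: push_ev_rep. Qed.
Lemma push_counit_coc : push uext_counit (gen_coc H) = cunit.
Proof. exact: push_ev_coc. Qed.
Lemma push_counit_inv : push uext_counit (gen_inv H) = cunit.
Proof. exact: push_ev_inv. Qed.

Fact assoc_commute1 (x y : B) :
  j1 x ⋅ ah_comp j2 i1 y = ah_comp j2 i1 y ⋅ j1 x.
Proof. exact: tincl_commute. Qed.
Definition assoc_left : alghom (tensor_alg B B) (tensor_alg B BB) := tpair assoc_commute1.
Fact assoc_commute2 (x y : B) :
  ah_comp assoc_left uext_comul x ⋅ ah_comp j2 i2 y
  = ah_comp j2 i2 y ⋅ ah_comp assoc_left uext_comul x.
Proof.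
change (assoc_left (uext_comul x) ⋅ j2 (i2 y) = j2 (i2 y) ⋅ assoc_left (uext_comul x)).
elim/tensor_ind: (uext_comul x) => [|t t' IH IH'|v w].
- by rewrite linear0 ua_mul0l ua_mul0r.
- by rewrite linearD ua_mulDl ua_mulDr IH IH'.
have C1 : j2 (i1 w) ⋅ j2 (i2 y) = j2 (i2 y) ⋅ j2 (i1 w).
  by rewrite -!(ah_mul j2) tincl_commute.
have C2 : j1 v ⋅ j2 (i2 y) = j2 (i2 y) ⋅ j1 v := tincl_commute v (i2 y).
transitivity (j1 v ⋅ j2 (i1 w) ⋅ j2 (i2 y)).
  by congr (_ ⋅ _); apply: tpair_linE.
rewrite -ua_mulA C1 ua_mulA C2 -ua_mulA; congr (_ ⋅ _).
exact/esym/tpair_linE.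
Qed.

(** Both sides are algebra maps from B to B ⊗ (B ⊗ B), so they are compared on
the generators, where coassociativity becomes associativity of convolution. *)
Lemma uext_comulA (b : B) :
  \sum_(p <- repr (uext_comul b)) \sum_(q <- repr (uext_comul p.1)) q.1 ⊗ (q.2 ⊗ p.2)
  = \sum_(p <- repr (uext_comul b)) \sum_(q <- repr (uext_comul p.2)) p.1 ⊗ (q.1 ⊗ q.2).
Proof.
pose c2 (x y : B) : j1 x ⋅ ah_comp j2 uext_comul y = ah_comp j2 uext_comul y ⋅ j1 x :=
  tincl_commute x (uext_comul y).
transitivity (ah_comp (tpair assoc_commute2) uext_comul b).
  apply: esym; rewrite [LHS](tpairE assoc_commute2); apply: eq_bigr => p _.
  transitivity ((\sum_(q <- repr (uext_comul p.1)) j1 q.1 ⋅ ah_comp j2 i1 q.2)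
                ⋅ j2 (i2 p.2)); first by [].
  rewrite ua_suml; apply: eq_bigr => q _.
  rewrite -ua_mulA -(ah_mul j2) [LHS](tincl12 _ (_ : BB)).
  by congr (_ ⊗ _); apply: tincl12.
transitivity (ah_comp (tpair c2) uext_comul b); last first.
  rewrite [LHS](tpairE c2); apply: eq_bigr => p _.
  rewrite -[RHS](bilin_sumr (tens_bilinear B BB)) -tensor_repr.
  exact: (tincl12 _ (uext_comul p.2 : BB)).
apply: (uext_hom_eq (f := ah_comp (tpair assoc_commute2) uext_comul)
                   (g := ah_comp (tpair c2) uext_comul)); rewrite !push_comp.
- rewrite !push_comul_rep !push_conv !push_tpair_incl1 !push_tpair_incl2 !push_comp.
  rewrite push_comul_rep !push_conv !push_tpair_incl1 !push_tpair_incl2 !push_comp.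
  by rewrite convA.
- rewrite !push_comul_coc !push_conv !push_tpair_incl1 !push_tpair_incl2 !push_comp.
  rewrite push_comul_coc !push_conv !push_tpair_incl1 !push_tpair_incl2 !push_comp.
  by rewrite convA.
- rewrite !push_comul_inv !push_conv !push_tpair_incl1 !push_tpair_incl2 !push_comp.
  rewrite push_comul_inv !push_conv !push_tpair_incl1 !push_tpair_incl2 !push_comp.
  by rewrite convA.
Qed.

Lemma uext_counitl (b : B) :
  \sum_(p <- repr (uext_comul b)) (uext_counit p.1 : k) *: p.2 = b.
Proof.
pose e := ah_comp (unit_hom (alg_of B)) uext_counit.
have eC (x y : B) : e x ⋅ ah_id (alg_of B) y = ah_id (alg_of B) y ⋅ e x.
  exact: unit_hom_central.
transitivity (ah_comp (tpair eC) uext_comul b).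
  apply: esym; rewrite [LHS](tpairE eC); apply: eq_bigr => p _.
  transitivity (((uext_counit p.1 : k) *: ua_one (alg_of B)) ⋅ (p.2 : alg_of B)) => //.
  by rewrite ua_mulZl ua_mul1l.
apply: (uext_hom_eq (f := ah_comp (tpair eC) uext_comul) (g := ah_id (alg_of B)));
  rewrite push_comp push_id.
- rewrite push_comul_rep !push_conv push_tpair_incl1 push_tpair_incl2 push_comp.
  by rewrite push_counit_rep push_unit_hom push_id conv1f.
- rewrite push_comul_coc !push_conv push_tpair_incl1 push_tpair_incl2 push_comp.
  by rewrite push_counit_coc push_unit push_id conv1f.
- rewrite push_comul_inv !push_conv push_tpair_incl1 push_tpair_incl2 push_comp.
  by rewrite push_counit_inv push_unit push_id convf1.
Qed.

Lemma uext_counitr (b : B) :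
  \sum_(p <- repr (uext_comul b)) (uext_counit p.2 : k) *: p.1 = b.
Proof.
pose e := ah_comp (unit_hom (alg_of B)) uext_counit.
have eC (x y : B) : ah_id (alg_of B) x ⋅ e y = e y ⋅ ah_id (alg_of B) x.
  exact/esym/unit_hom_central.
transitivity (ah_comp (tpair eC) uext_comul b).
  apply: esym; rewrite [LHS](tpairE eC); apply: eq_bigr => p _.
  transitivity ((p.1 : alg_of B) ⋅ ((uext_counit p.2 : k) *: ua_one (alg_of B))) => //.
  by rewrite ua_mulZr ua_mul1r.
apply: (uext_hom_eq (f := ah_comp (tpair eC) uext_comul) (g := ah_id (alg_of B)));
  rewrite push_comp push_id.
- rewrite push_comul_rep !push_conv push_tpair_incl1 push_tpair_incl2 push_comp.
  by rewrite push_counit_rep push_unit_hom push_id convf1.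
- rewrite push_comul_coc !push_conv push_tpair_incl1 push_tpair_incl2 push_comp.
  by rewrite push_counit_coc push_unit push_id convf1.
- rewrite push_comul_inv !push_conv push_tpair_incl1 push_tpair_incl2 push_comp.
  by rewrite push_counit_inv push_unit push_id conv1f.
Qed.

HB.instance Definition _ := @Lmodule_isCoalgebra.Build k B
  uext_comul uext_counit uext_comulA uext_counitl uext_counitr.

Lemma sweedler_uextM (W : lmodType k) (b : B -> B -> W) (x y : B) : is_bilinear b ->
  \sum_(p <- sweedler (x * y)) b p.1 p.2
  = \sum_(p <- sweedler x) \sum_(q <- sweedler y) b (p.1 * q.1) (p.2 * q.2).
Proof.
move=> bP; rewrite sweedler_sum [comul (x * y)](ah_mul uext_comul x y).
rewrite /= /tmul tensor_sum_sum //; apply: eq_bigr => p _.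
by rewrite tensor_sum_sum //; apply: eq_bigr => q _; rewrite tensor_sumE.
Qed.

Lemma gen_rep_comul h : comul (gen_rep H h : B) =
  \sum_(p <- sweedler h) (gen_rep H p.1 : B) ⊗ (gen_rep H p.2 : B).
Proof.
rewrite -(conv_tincl (gen_rep H) (gen_rep H)).
exact: (congr1 (fun f : {linear _ -> _} => f h) push_comul_rep).
Qed.
Lemma gen_coc_comul c : comul (gen_coc H c : B) =
  \sum_(p <- sweedler c) (gen_coc H p.1 : B) ⊗ (gen_coc H p.2 : B).
Proof.
rewrite -(conv_tincl (gen_coc H) (gen_coc H)).
exact: (congr1 (fun f : {linear _ -> _} => f c) push_comul_coc).
Qed.
Lemma gen_inv_comul c : comul (gen_inv H c : B) =
  \sum_(p <- sweedler c) (gen_inv H p.2 : B) ⊗ (gen_inv H p.1 : B).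
Proof.
rewrite -(conv_tincl_rev (gen_inv H) (gen_inv H)).
exact: (congr1 (fun f : {linear _ -> _} => f c) push_comul_inv).
Qed.
Lemma gen_rep_counit h : counit (gen_rep H h : B) = counit h.
Proof. exact: (congr1 (fun f : {linear _ -> _} => f h) push_counit_rep). Qed.
Lemma gen_coc_counit c : counit (gen_coc H c : B) = counit c.
Proof.
rewrite [LHS](congr1 (fun f : {linear _ -> _} => f c) push_counit_coc) cunitE.
exact: mulr1.
Qed.
Lemma gen_inv_counit c : counit (gen_inv H c : B) = counit c.
Proof.
rewrite [LHS](congr1 (fun f : {linear _ -> _} => f c) push_counit_inv) cunitE.
exact: mulr1.
Qed.

Lemma sweedler_uext1 (W : lmodType k) (b : B -> B -> W) : is_bilinear b ->
  \sum_(p <- sweedler (1 : B)) b p.1 p.2 = b 1 1.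
Proof.
by move=> bP; rewrite sweedler_sum [comul (1 : B)](ah_one uext_comul) tensor_sumE.
Qed.
Lemma sweedler_gen_rep (W : lmodType k) (b : B -> B -> W) h : is_bilinear b ->
  \sum_(p <- sweedler (gen_rep H h : B)) b p.1 p.2
  = \sum_(p <- sweedler h) b (gen_rep H p.1) (gen_rep H p.2).
Proof.
move=> bP; rewrite sweedler_sum gen_rep_comul tensor_sum_sum //.
by apply: eq_bigr => p _; rewrite tensor_sumE.
Qed.
Lemma sweedler_gen_coc (W : lmodType k) (b : B -> B -> W) c : is_bilinear b ->
  \sum_(p <- sweedler (gen_coc H c : B)) b p.1 p.2
  = \sum_(p <- sweedler c) b (gen_coc H p.1) (gen_coc H p.2).
Proof.
move=> bP; rewrite sweedler_sum gen_coc_comul tensor_sum_sum //.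
by apply: eq_bigr => p _; rewrite tensor_sumE.
Qed.
Lemma sweedler_gen_inv (W : lmodType k) (b : B -> B -> W) c : is_bilinear b ->
  \sum_(p <- sweedler (gen_inv H c : B)) b p.1 p.2
  = \sum_(p <- sweedler c) b (gen_inv H p.2) (gen_inv H p.1).
Proof.
move=> bP; rewrite sweedler_sum gen_inv_comul tensor_sum_sum //.
by apply: eq_bigr => p _; rewrite tensor_sumE.
Qed.

Definition uext_antipode_hom : alghom (alg_of B) (op_alg (alg_of B)) :=
  ev_hom (op_twisted u).
Definition uext_antipode : {linear B -> B} := uext_antipode_hom.

Lemma uext_antipodeM (x y : B) : uext_antipode (x * y) = uext_antipode y * uext_antipode x.
Proof. exact: (ah_mul uext_antipode_hom). Qed.
Lemma uext_antipode1 : uext_antipode 1 = 1.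
Proof. exact: (ah_one uext_antipode_hom). Qed.
Lemma uext_antipode_rep h : uext_antipode (gen_rep H h) = tw_dual u h.
Proof. exact: (ev_rep (op_twisted u)). Qed.
Lemma uext_antipode_coc c : uext_antipode (gen_coc H c) = gen_inv H c.
Proof. exact: (ev_coc (op_twisted u)). Qed.
Lemma uext_antipode_inv c : uext_antipode (gen_inv H c) = gen_coc H c.
Proof. exact: (ev_inv (op_twisted u)). Qed.

(** The antipode axioms hold on the generators, and they are stable under
products because the antipode is antimultiplicative. *)
Let Sl : {linear B -> alg_of B} := uext_antipode.
Let Il : {linear B -> alg_of B} := idfun.

Fact uext_antipodel (b : B) : (Sl ⋆ Il) b = (counit b : k)%:A.
Proof.
have bP := conv_bilin Sl Il.
elim/uext_ind: b => [||x y IHx IHy|a x IHx|x y IHx IHy|h|c|c].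
- by rewrite !linear0 scale0r.
- rewrite convE (sweedler_uext1 bP) [counit _](ah_one uext_counit) scale1r.
  by rewrite [Sl 1]uext_antipode1 [LHS]mul1r.
- by rewrite !linearD IHx IHy scalerDl.
- by rewrite !linearZ /= IHx; apply: scalerA.
- rewrite convE (sweedler_uextM _ _ bP) exchange_big /=.
  transitivity (\sum_(q <- sweedler y) uext_antipode q.1 * ((Sl ⋆ Il) x : B) * q.2).
    apply: eq_bigr => q _; rewrite convE mulr_sumr mulr_suml; apply: eq_bigr => p _.
    transitivity (uext_antipode (p.1 * q.1) * (p.2 * q.2)) => //.
    by rewrite uext_antipodeM !mulrA.
  under eq_bigr => q _ do rewrite IHx -scalerAr mulr1 -scalerAl.
  rewrite -scaler_sumr [X in _ *: X]IHy scalerA.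
  exact: (congr1 (fun a : k => a *: (1 : B)) (esym (ah_mul uext_counit x y))).
- rewrite convE (sweedler_gen_rep _ bP) gen_rep_counit.
  transitivity ((cunit : {linear H -> alg_of B}) h) => //.
  by rewrite -(tw_dual_convl u); apply: eq_bigr => p _; rewrite [Sl _]uext_antipode_rep.
- rewrite convE (sweedler_gen_coc _ bP) gen_coc_counit.
  transitivity ((cunit : {linear tensor H H -> alg_of B}) c) => //.
  by rewrite -(tw_convl u); apply: eq_bigr => p _; rewrite [Sl _]uext_antipode_coc.
- rewrite convE (sweedler_gen_inv _ bP) gen_inv_counit.
  transitivity ((cunit : {linear tensor H H -> alg_of B}) c) => //.
  rewrite -(tw_convl u); apply: eq_bigr => p _.
  by rewrite [Sl _]uext_antipode_inv (tw_coc_central u).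
Qed.

Fact uext_antipoder (b : B) : (Il ⋆ Sl) b = (counit b : k)%:A.
Proof.
have bP := conv_bilin Il Sl.
elim/uext_ind: b => [||x y IHx IHy|a x IHx|x y IHx IHy|h|c|c].
- by rewrite !linear0 scale0r.
- rewrite convE (sweedler_uext1 bP) [counit _](ah_one uext_counit) scale1r.
  by rewrite [Sl 1]uext_antipode1 [LHS]mul1r.
- by rewrite !linearD IHx IHy scalerDl.
- by rewrite !linearZ /= IHx; apply: scalerA.
- rewrite convE (sweedler_uextM _ _ bP).
  transitivity (\sum_(p <- sweedler x) p.1 * ((Il ⋆ Sl) y : B) * uext_antipode p.2).
    apply: eq_bigr => p _; rewrite convE mulr_sumr mulr_suml; apply: eq_bigr => q _.
    transitivity (p.1 * q.1 * uext_antipode (p.2 * q.2)) => //.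
    by rewrite uext_antipodeM !mulrA.
  under eq_bigr => p _ do rewrite IHy -scalerAr mulr1 -scalerAl.
  rewrite -scaler_sumr [X in _ *: X]IHx scalerA mulrC.
  exact: (congr1 (fun a : k => a *: (1 : B)) (esym (ah_mul uext_counit x y))).
- rewrite convE (sweedler_gen_rep _ bP) gen_rep_counit.
  transitivity ((cunit : {linear H -> alg_of B}) h) => //.
  by rewrite -(tw_dual_convr u); apply: eq_bigr => p _; rewrite [Sl _]uext_antipode_rep.
- rewrite convE (sweedler_gen_coc _ bP) gen_coc_counit.
  transitivity ((cunit : {linear tensor H H -> alg_of B}) c) => //.
  by rewrite -(tw_convr u); apply: eq_bigr => p _; rewrite [Sl _]uext_antipode_coc.
- rewrite convE (sweedler_gen_inv _ bP) gen_inv_counit.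
  transitivity ((cunit : {linear tensor H H -> alg_of B}) c) => //.
  rewrite -(tw_convr u); apply: eq_bigr => p _.
  by rewrite [Sl _]uext_antipode_inv (tw_inv_central u).
Qed.

Fact uext_comul_morphism : monoid_morphism (comul : B -> tensor B B).
Proof. by split; [apply: (ah_one uext_comul) | apply: (ah_mul uext_comul)]. Qed.
Fact uext_counit_morphism : monoid_morphism (counit : B -> k).
Proof. by split; [apply: (ah_one uext_counit) | apply: (ah_mul uext_counit)]. Qed.
HB.instance Definition _ := @Algebra_Coalgebra_isHopf.Build k B
  uext_comul_morphism uext_counit_morphism uext_antipode
  uext_antipodel uext_antipoder.
End UniversalHopfAlgebra.

(** * The central extension *)

Section CentralExtension.
Variables (k : fieldType) (H : hopfAlgType k).
Local Notation B := (uext H).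
Local Notation u := (uext_twisted H).

Inductive cocycle_subalg : B -> Prop :=
| Subalg0 : cocycle_subalg 0
| Subalg1 : cocycle_subalg 1
| SubalgL a x y : cocycle_subalg x -> cocycle_subalg y -> cocycle_subalg (a *: x + y)
| SubalgM x y : cocycle_subalg x -> cocycle_subalg y -> cocycle_subalg (x * y)
| SubalgCoc c : cocycle_subalg (gen_coc H c)
| SubalgInv c : cocycle_subalg (gen_inv H c).
Local Notation A := cocycle_subalg.

Lemma cocycle_subalg_central : central A.
Proof.
move=> x b; elim => {x} [||a x y _ IHx _ IHy|x y _ IHx _ IHy|c|c].
- by rewrite mul0r mulr0.
- by rewrite mul1r mulr1.
- by rewrite mulrDl mulrDr -scalerAl -scalerAr IHx IHy.
- by rewrite -mulrA IHy mulrA IHx mulrA.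
- exact: (tw_coc_central u).
- exact: (tw_inv_central u).
Qed.

Definition tens_subalg (t : tensor B B) := exists s : seq (B * B),
  (forall p, p \in s -> A p.1 /\ A p.2) /\ t = \sum_(p <- s) p.1 ⊗ p.2.

Lemma tens_subalg_pure x y : A x -> A y -> tens_subalg (x ⊗ y).
Proof.
move=> Ax Ay; exists [:: (x, y)]; rewrite big_seq1; split=> // p.
by rewrite inE => /eqP ->.
Qed.

Lemma tens_subalgZ a t : tens_subalg t -> tens_subalg (a *: t).
Proof.
case=> s [sA ->]; exists [seq (a *: p.1, p.2) | p <- s]; split.
  move=> _ /mapP[p /sA[A1 A2] ->]; split=> //=.
  by rewrite -[_ *: _]addr0; apply: SubalgL => //; apply: Subalg0.
rewrite big_map scaler_sumr; apply: eq_bigr => p _ /=.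
by rewrite (bilinZl (tens_bilinear B B)).
Qed.

Lemma tens_subalgD t t' : tens_subalg t -> tens_subalg t' -> tens_subalg (t + t').
Proof.
move=> [s [sA ->]] [s' [sA' ->]]; exists (s ++ s'); rewrite big_cat.
by split=> // p; rewrite mem_cat => /orP[/sA|/sA'].
Qed.

Lemma tens_subalg_sum (I : Type) (s : seq I) (F : I -> tensor B B) :
  (forall i, tens_subalg (F i)) -> tens_subalg (\sum_(i <- s) F i).
Proof.
move=> FA; apply: (big_ind tens_subalg) => //; last exact: tens_subalgD.
by exists [::]; rewrite big_nil.
Qed.

Lemma tens_subalgM t t' : tens_subalg t -> tens_subalg t' -> tens_subalg (t * t').
Proof.
case=> s [sA ->] [s' [sA' ->]].
exists [seq (p.1 * q.1, p.2 * q.2) | p <- s, q <- s']; split.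
  move=> _ /allpairsP[[p q] /= [/sA[A1 A2] /sA'[A1' A2'] ->]] /=.
  by split; apply: SubalgM.
rewrite big_allpairs_dep /= mulr_suml; apply: eq_bigr => p _; rewrite mulr_sumr.
by apply: eq_bigr => q _; apply: tmulE.
Qed.

Lemma cocycle_subalg_hopf : hopf_subalgebra A.
Proof.
split.
- exact: Subalg1.
- exact: SubalgL.
- exact: SubalgM.
- move=> x; elim => {x} [||a x y _ IHx _ IHy|x y _ IHx _ IHy|c|c].
  + by rewrite linear0; exists [::]; rewrite big_nil.
  + by rewrite comul1; apply: tens_subalg_pure; apply: Subalg1.
  + by rewrite linearP; apply: tens_subalgD => //; apply: tens_subalgZ.
  + by rewrite comulM; apply: tens_subalgM.
  + rewrite gen_coc_comul; apply: tens_subalg_sum => p.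
    by apply: tens_subalg_pure; apply: SubalgCoc.
  + rewrite gen_inv_comul; apply: tens_subalg_sum => p.
    by apply: tens_subalg_pure; apply: SubalgInv.
- move=> x; elim => {x} [||a x y _ IHx _ IHy|x y _ IHx _ IHy|c|c].
  + by rewrite linear0; apply: Subalg0.
  + by rewrite [antipode 1]uext_antipode1; apply: Subalg1.
  + by rewrite linearP; apply: SubalgL.
  + by rewrite [antipode _]uext_antipodeM; apply: SubalgM.
  + by rewrite [antipode _]uext_antipode_coc; apply: SubalgInv.
  + by rewrite [antipode _]uext_antipode_inv; apply: SubalgCoc.
Qed.

Definition uext_proj : alghom (alg_of B) (alg_of H) :=
  ev_hom (hom_twisted (ah_id (alg_of H))).

Lemma push_proj_rep : push uext_proj (gen_rep H) = id_lin H.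
Proof. by rewrite push_ev_rep; apply: linear_eq. Qed.
Lemma push_proj_coc : push uext_proj (gen_coc H) = cunit.
Proof. exact: push_ev_coc. Qed.
Lemma push_proj_inv : push uext_proj (gen_inv H) = cunit.
Proof. exact: push_ev_inv. Qed.
Lemma proj_rep h : uext_proj (gen_rep H h) = h.
Proof. exact: (congr1 (fun f : {linear _ -> _} => f h) push_proj_rep). Qed.
Lemma proj_coc c : uext_proj (gen_coc H c) = (counit c : k)%:A.
Proof. exact: (congr1 (fun f : {linear _ -> _} => f c) push_proj_coc). Qed.
Lemma proj_inv c : uext_proj (gen_inv H c) = (counit c : k)%:A.
Proof. exact: (congr1 (fun f : {linear _ -> _} => f c) push_proj_inv). Qed.

Lemma uext_proj_counit (b : B) : counit (uext_proj b) = counit b.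
Proof.
apply: (uext_hom_eq (f := ah_comp (counit_hom H) uext_proj) (g := uext_counit H));
  rewrite push_comp.
- by rewrite push_proj_rep push_counit_rep; apply: linear_eq.
- by rewrite push_proj_coc push_counit_coc push_unit.
- by rewrite push_proj_inv push_counit_inv push_unit.
Qed.

Lemma uext_proj_comul (b : B) :
  comul (uext_proj b) = \sum_(p <- sweedler b) uext_proj p.1 ⊗ uext_proj p.2.
Proof.
pose f1 := ah_comp (tincl1 H H) uext_proj; pose f2 := ah_comp (tincl2 H H) uext_proj.
have fC x y : f1 x ⋅ f2 y = f2 y ⋅ f1 x by apply: tincl_commute.
transitivity (ah_comp (tpair fC) (uext_comul H) b); last first.
  rewrite [LHS](tpairE fC); apply: eq_bigr => p _; exact: tincl12.
have idE : push (comul_hom H) (id_lin H)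
    = push (tincl1 H H) (id_lin H) ⋆ push (tincl2 H H) (id_lin H).
  by apply: linear_eq => x; rewrite conv_tincl; exact: tensor_repr.
apply: (uext_hom_eq (f := ah_comp (comul_hom H) uext_proj)
  (g := ah_comp (tpair fC) (uext_comul H))); rewrite !push_comp.
- rewrite push_proj_rep push_comul_rep push_conv push_tpair_incl1 push_tpair_incl2.
  by rewrite !push_comp push_proj_rep.
- rewrite push_proj_coc push_comul_coc push_conv push_tpair_incl1 push_tpair_incl2.
  by rewrite !push_comp push_proj_coc !push_unit conv1f.
- rewrite push_proj_inv push_comul_inv push_conv push_tpair_incl1 push_tpair_incl2.
  by rewrite !push_comp push_proj_inv !push_unit conv1f.
Qed.

Definition uext_proj_coalg : coalghom B H :=
  @CoalgHom k B H uext_proj uext_proj_comul uext_proj_counit.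

Definition alghom_lrmorphism (X Y : algType k) (f : alghom (alg_of X) (alg_of Y)) :
    {lrmorphism X -> Y} :=
  HB.pack_for {lrmorphism X -> Y} (f : X -> Y)
    (GRing.isLinear.Build k X Y *:%R f (fun a x y => linearP f a x y))
    (GRing.isMonoidMorphism.Build X Y f (conj (ah_one f) (ah_mul f))).

(** Any bialgebra map preserves antipodes: both sides are convolution inverse to
the projection. *)
Lemma uext_proj_antipode (b : B) : uext_proj (antipode b) = antipode (uext_proj b).
Proof.
have E : push uext_proj (antipode_lin B) = pull uext_proj_coalg (antipode_lin H).
  apply: (@conv_inv_uniq _ _ _ _ (push uext_proj (id_lin B))).
    by rewrite -push_conv antipode_convl push_unit.
  have -> : push uext_proj (id_lin B) = pull uext_proj_coalg (id_lin H) by apply: linear_eq.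
  by rewrite -pull_conv antipode_convr pull_unit.
exact: (congr1 (fun f : {linear _ -> _} => f b) E).
Qed.

Section AugmentationIdeal.
Local Notation I := (augmentation_ideal A).

Lemma aug0 : I 0.
Proof. by exists [::]; rewrite big_nil. Qed.
Lemma augD x y : I x -> I y -> I (x + y).
Proof.
move=> [s [sA ->]] [t [tA ->]]; exists (s ++ t); rewrite big_cat.
by split=> // p; rewrite mem_cat => /orP[/sA|/tA].
Qed.
Lemma augMl b x : I x -> I (b * x).
Proof.
move=> [s [sA ->]]; exists [seq (b * p.1, p.2) | p <- s]; split.
  by move=> _ /mapP[p /sA h ->].
by rewrite big_map mulr_sumr; apply: eq_bigr => p _; rewrite mulrA.
Qed.
Lemma augMr b x : I x -> I (x * b).
Proof.
move=> [s [sA ->]]; exists [seq (p.1 * b, p.2) | p <- s]; split.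
  by move=> _ /mapP[p /sA h ->].
rewrite big_map mulr_suml; apply: eq_big_seq => p /sA[pA _] /=.
by rewrite -!mulrA; congr (_ * _); apply: cocycle_subalg_central.
Qed.
Lemma augZ a x : I x -> I (a *: x).
Proof. by move=> Ix; rewrite -[x]mul1r scalerAl; apply: augMl. Qed.
Lemma aug_sum (T : Type) (s : seq T) F : (forall i, I (F i)) -> I (\sum_(i <- s) F i).
Proof. by move=> h; apply: (big_ind I) => //; [apply: aug0 | apply: augD]. Qed.
Lemma aug_cocycle_subalg x : A x -> I (x - (counit x : k)%:A).
Proof.
move=> Ax; exists [:: (1, x - (counit x : k)%:A)]; rewrite big_seq1 mul1r.
have c0 : counit (x - (counit x : k)%:A) = 0 :> k.
  rewrite linearB linearZ counit1.
  exact: etrans (congr1 (fun z : k => (counit x : k) - z) (mulr1 _)) (subrr _).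
split=> // p; rewrite inE => /eqP ->; split; last exact: c0.
  rewrite addrC -scaleNr; apply: SubalgL => //; exact: Subalg1.
Qed.

Lemma proj_cocycle_subalg x : A x -> uext_proj x = (counit x : k)%:A.
Proof.
elim => {x} [||a x y _ IHx _ IHy|x y _ IHx _ IHy|c|c].
- by rewrite !linear0 scale0r.
- by rewrite [LHS](ah_one uext_proj) counit1 scale1r.
- rewrite (linearP uext_proj) IHx IHy (linearP (counit : {linear B -> k^o})).
  by rewrite scalerDl scalerA.
- rewrite [LHS](ah_mul uext_proj) IHx IHy counitM /=.
  by rewrite -scalerAl mul1r scalerA.
- by rewrite proj_coc gen_coc_counit.
- by rewrite proj_inv gen_inv_counit.
Qed.

Lemma aug_proj b : I b -> uext_proj b = 0.
Proof.
move=> [s [sA ->]]; rewrite linear_sum big_seq big1 // => p /sA[pA p0].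
by rewrite [LHS](ah_mul uext_proj) (proj_cocycle_subalg pA) p0 scale0r; apply: mulr0.
Qed.

(** rep is a section of the projection modulo B A^+.  For a product the defect is
(coc(c_1) - counit(c_1)) rep(m(c_2)), which lies in the ideal. *)
Lemma aug_section b : I (b - gen_rep H (uext_proj b)).
Proof.
elim/uext_ind: b => [||x y IHx IHy|a x IHx|x y IHx IHy|h|c|c].
- by rewrite !linear0 addr0; apply: aug0.
- rewrite [uext_proj 1](ah_one uext_proj) [gen_rep H _](tw_one u) subrr; exact: aug0.
- by rewrite !linearD addrACA; apply: augD.
- by rewrite !linearZ -scalerDr; apply: augZ.
- rewrite [uext_proj _](ah_mul uext_proj).
  set h := uext_proj x; set l := uext_proj y.
  have -> : x * y - gen_rep H (h ⋅ l)
     = (x - gen_rep H h) * y + gen_rep H h * (y - gen_rep H l)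
     + (gen_rep H h * gen_rep H l - gen_rep H (h ⋅ l)).
    by rewrite mulrBl mulrBr !addrA !subrK.
  apply: augD; first by apply: augD; [apply: augMr | apply: augMl].
  rewrite [X in X - _](tw_mulE u h l) convE.
  have -> : gen_rep H (h ⋅ l) = \sum_(p <- sweedler (h ⊗ l))
      (counit p.1 : k) *: (gen_rep H (mulc H p.2) : B).
    rewrite (counit_sum1 (W := alg_of B) (pull (mulc H) (gen_rep H))).
    by rewrite pullE mulcE.
  rewrite -sumrB; apply: aug_sum => p.
  have -> : (gen_coc H p.1 ⋅ pull (mulc H) (gen_rep H) p.2 : B)
      - (counit p.1 : k) *: (gen_rep H (mulc H p.2) : B)
      = (gen_coc H p.1 - (counit (gen_coc H p.1 : B) : k)%:A)
        * (gen_rep H (mulc H p.2) : B).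
    by rewrite mulrBl -scalerAl mul1r gen_coc_counit.
  by apply/augMr/aug_cocycle_subalg/SubalgCoc.
- by rewrite proj_rep subrr; apply: aug0.
- rewrite proj_coc linearZ [gen_rep H 1](tw_one u) -gen_coc_counit.
  by apply: aug_cocycle_subalg; apply: SubalgCoc.
- rewrite proj_inv linearZ [gen_rep H 1](tw_one u) -gen_inv_counit.
  by apply: aug_cocycle_subalg; apply: SubalgInv.
Qed.
End AugmentationIdeal.

Lemma uext_central_extension :
  central_extension A (alghom_lrmorphism uext_proj).
Proof.
split.
- exact: cocycle_subalg_hopf.
- exact: cocycle_subalg_central.
- split.
  + exact: uext_proj_comul.
  + exact: uext_proj_counit.
  + exact: uext_proj_antipode.
- by move=> h; exists (gen_rep H h); apply: proj_rep.
- move=> b; split; last exact: aug_proj.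
  move=> b0; rewrite -[b]subr0; have := aug_section b.
  by have -> : uext_proj b = 0 by []; rewrite linear0.
Qed.
End CentralExtension.

(** * The regular projective representation *)

Section Regular.
Variables (k : fieldType) (H : hopfAlgType k).
Variables (alpha beta : {linear tensor H H -> k^o}).
Hypothesis alpha_coc : left_2cocycle alpha.
Hypothesis alpha_norm : normalized alpha.
Hypothesis alpha_lazy : lazy alpha.
Hypothesis ab : forall c, convolution alpha beta c = counit c.
Hypothesis ba : forall c, convolution beta alpha c = counit c.
Local Notation HA := (alg_of H).
Local Notation m := (mulc H).

Definition mul_alg : {linear tensor H H -> HA} := m.
Definition twmul : {linear tensor H H -> HA} := scal alpha ⋆ mul_alg.

Lemma twmul_tens x y : twmul (x ⊗ y) =
  \sum_(p <- sweedler x) \sum_(q <- sweedler y) (alpha (p.1 ⊗ q.1) : k) *: (p.2 * q.2).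
Proof.
rewrite [LHS]conv_tens; apply: eq_bigr => p _; apply: eq_bigr => q _.
by rewrite scalE ua_mulZl ua_mul1l [mul_alg _]mulcE.
Qed.

Lemma twmul1 y : twmul (1 ⊗ y) = y.
Proof.
rewrite twmul_tens exchange_big.
under eq_bigr => q _.
  have bP : is_bilinear (fun x z : H => (alpha (x ⊗ q.1) : k) *: (z * q.2)).
    split=> v a x y' /=; first by rewrite tensDl linearP scalerDl -scalerA.
    by rewrite mulrDl scalerDr -scalerAl !scalerA mulrC.
  rewrite (sweedler1 bP) mul1r (alpha_norm q.1).1.
over.
exact: comul_counitl.
Qed.

(** The two sides of the cocycle identity, as functions of the pairs x ⊗ y and
y ⊗ z respectively. *)
Let K (c : tensor H H) (z : H) : k :=
  \sum_(p <- sweedler c) alpha p.1 * alpha (m p.2 ⊗ z).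
Let K' (z : H) (e : tensor H H) : k :=
  \sum_(p <- sweedler e) alpha p.1 * alpha (z ⊗ m p.2).

Fact cocycle_KK' x y z : K (x ⊗ y) z = K' x (y ⊗ z).
Proof.
have bP : is_bilinear (fun c d : tensor H H => alpha c * alpha (m d ⊗ z) : k^o).
  split=> v a c d /=; first by rewrite linearP mulrDl -mulrA.
  by rewrite linearP tensDl linearP mulrDr mulrCA.
have bP' : is_bilinear (fun c d : tensor H H => alpha c * alpha (x ⊗ m d) : k^o).
  split=> v a c d /=; first by rewrite linearP mulrDl -mulrA.
  by rewrite linearP tensDr linearP mulrDr mulrCA.
rewrite /K /K' [LHS](sweedler_tens _ _ bP) [RHS](sweedler_tens _ _ bP').
under eq_bigr => p _ do under eq_bigr => q _ do rewrite mulcE.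
by rewrite alpha_coc; under [RHS]eq_bigr => p _ do under eq_bigr => q _ do rewrite mulcE.
Qed.

Let slicer (z : H) : {linear H -> k^o} :=
  mk_linear (f := fun x : H => alpha (x ⊗ z) : k^o)
    (fun a x y => etrans (congr1 alpha (tensDl z a x y)) (linearP alpha a _ _)).
Let slicel (z : H) : {linear H -> k^o} :=
  mk_linear (f := fun x : H => alpha (z ⊗ x) : k^o)
    (fun a x y => etrans (congr1 alpha (tensDr z a x y)) (linearP alpha a _ _)).
Let mulr_by (z : H) : {linear H -> HA} := mk_linear ((alg_of_bilin H).1 z).
Let mull_by (z : H) : {linear H -> HA} := mk_linear ((alg_of_bilin H).2 z).

Fact twmulEr x y : twmul (x ⊗ y) =
  \sum_(q <- sweedler y) (scal (slicer q.1) ⋆ mulr_by q.2) x.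
Proof.
rewrite twmul_tens exchange_big; apply: eq_bigr => q _; rewrite conv_scall.
by apply: eq_bigr.
Qed.
Fact twmulEl x y : twmul (x ⊗ y) =
  \sum_(p <- sweedler x) (scal (slicel p.1) ⋆ mull_by p.2) y.
Proof.
by rewrite twmul_tens; apply: eq_bigr => p _; rewrite conv_scall.
Qed.

Fact conv_K c z : (scal alpha ⋆ pull m (scal (slicer z)) : {linear _ -> HA}) c
  = (K c z)%:A.
Proof.
rewrite conv_scall /K scaler_suml; apply: eq_bigr => p _.
by rewrite pullE scalE scalerA.
Qed.
Fact conv_K' c z : (scal alpha ⋆ pull m (scal (slicel z)) : {linear _ -> HA}) c
  = (K' z c)%:A.
Proof.
rewrite conv_scall /K' scaler_suml; apply: eq_bigr => p _.
by rewrite pullE scalE scalerA.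
Qed.

(** Associativity up to alpha of the twisted product.  Coassociativity in H ⊗ H
collects the values of alpha on both sides into K and K', which agree by the
cocycle identity. *)
Lemma twmulA x y z : twmul (x ⊗ twmul (y ⊗ z)) =
  \sum_(p <- sweedler x) \sum_(q <- sweedler y)
    (alpha (p.1 ⊗ q.1) : k) *: twmul ((p.2 * q.2) ⊗ z).
Proof.
pose b1 (c d : tensor H H) : HA := (alpha c : k) *: twmul (m d ⊗ z).
have b1P : is_bilinear b1.
  split=> v a c d; rewrite /b1 /=; first by rewrite linearP scalerDl -scalerA.
  by rewrite linearP tensDl linearP scalerDr !scalerA mulrC.
transitivity (\sum_(p <- sweedler (x ⊗ y)) b1 p.1 p.2); last first.
  rewrite (sweedler_tens _ _ b1P); apply: eq_bigr => p _; apply: eq_bigr => q _.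
  by rewrite /b1 mulcE.
transitivity (\sum_(r <- sweedler z) \sum_(p <- sweedler x) \sum_(q <- sweedler y)
    K (p.1 ⊗ q.1) r.1 *: (p.2 * q.2 * r.2)); last first.
  pose g r : {linear tensor H H -> HA} :=
    scal alpha ⋆ pull m (scal (slicer r.1)) ⋆ pull m (mulr_by r.2).
  transitivity (\sum_(r <- sweedler z) g r (x ⊗ y)).
    apply: eq_bigr => r _; rewrite conv_tens; apply: eq_bigr => p _.
    apply: eq_bigr => q _; rewrite conv_K ua_mulZl ua_mul1l pullE.
    by rewrite mulcE.
  under eq_bigr => r _ do rewrite /g -convA -pull_conv conv_scall.
  rewrite exchange_big; apply: eq_bigr => p _; rewrite /b1 twmulEr scaler_sumr.
  by apply: eq_bigr => r _; rewrite pullE.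
transitivity (\sum_(p <- sweedler x) (scal alpha ⋆ pull m (scal (slicel p.1)) ⋆
    pull m (mull_by p.2)) (y ⊗ z)).
  have -> : twmul (y ⊗ z) = \sum_(c <- sweedler (y ⊗ z)) (alpha c.1 : k) *: m c.2.
    by rewrite [LHS]conv_scall.
  rewrite (bilin_sumr (tens_bilinear H H)) linear_sum.
  under [RHS]eq_bigr => p _ do rewrite -convA -pull_conv conv_scall.
  rewrite [RHS]exchange_big; apply: eq_bigr => c _.
  rewrite (bilinZr (tens_bilinear H H)) linearZ_LR twmulEl scaler_sumr.
  by apply: eq_bigr => p _; rewrite pullE.
rewrite [RHS]exchange_big /=; apply: eq_bigr => p _; rewrite [RHS]exchange_big.
rewrite conv_tens; apply: eq_bigr => q _; apply: eq_bigr => r _.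
by rewrite conv_K' ua_mulZl ua_mul1l pullE mulcE cocycle_KK' /= mulrA.
Qed.

Fact reg_linear1 (h : H) : linear (fun x : H => twmul (h ⊗ x) : H).
Proof. by move=> a x y; rewrite tensDr linearP. Qed.
Definition reg_fun (h : H) : End H := mk_linear (reg_linear1 h).
Fact reg_linear : linear reg_fun.
Proof.
by move=> a x y; apply: End_ext => z; rewrite /End_fun /= tensDl linearP.
Qed.
Definition reg : {linear H -> End_alg H} := mk_linear reg_linear.
Lemma regE h x : End_fun (reg h) x = twmul (h ⊗ x). Proof. by []. Qed.

Fact reg_one : reg 1 = ua_one (End_alg H).
Proof. by apply: End_ext => x; rewrite regE twmul1. Qed.

Fact End_fun_sum (V : lmodType k) (I : Type) (s : seq I) (F : I -> End V) v :
  End_fun (\sum_(i <- s) F i) v = \sum_(i <- s) End_fun (F i) v.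
Proof. by apply: (big_morph (fun f : End V => End_fun f v)). Qed.

Fact reg_mul x y : reg x ⋅ reg y =
  \sum_(p <- sweedler x) \sum_(q <- sweedler y)
    (alpha (p.1 ⊗ q.1) : k) *: reg (p.2 * q.2).
Proof.
apply: End_ext => z; rewrite [LHS]twmulA End_fun_sum; apply: eq_bigr => p _.
by rewrite End_fun_sum; apply: eq_bigr.
Qed.

Definition reg_twisted : twisted H (End_alg H) :=
  scal_twisted reg_one ab ba reg_mul alpha_lazy.
End Regular.

(** * Lifting projective representations *)

Section Lifting.
Variables (k : fieldType) (H : hopfAlgType k).
Variables (alpha beta : {linear tensor H H -> k^o}).
Hypothesis alpha_coc : left_2cocycle alpha.
Hypothesis alpha_norm : normalized alpha.
Hypothesis alpha_lazy : lazy alpha.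
Hypothesis ab : forall c, convolution alpha beta c = counit c.
Hypothesis ba : forall c, convolution beta alpha c = counit c.
Local Notation B := (uext H).
Local Notation pi := (uext_proj H).
Local Notation twmul := (twmul alpha).
Local Notation regt := (reg_twisted alpha_coc alpha_norm alpha_lazy ab ba).
Local Notation reg := (reg alpha).
Local Notation Xreg := (ev_hom regt).

Lemma twmul_comul t : comul (twmul t) = \sum_(p <- sweedler t) twmul p.1 ⊗ mulc H p.2.
Proof.
rewrite -(conv_tincl twmul (mul_alg H)) push_conv push_scal -convA.
have <- : push (comul_hom H) (mul_alg H)
    = push (tincl1 H H) (mul_alg H) ⋆ push (tincl2 H H) (mul_alg H).
  by apply: linear_eq => c; rewrite conv_tincl; exact: mul_comul.
by rewrite -(push_scal (comul_hom H)) -push_conv.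
Qed.

Fact End_fun_linear (V : lmodType k) (f : End V) : linear (End_fun f).
Proof. exact: (linearP (f : {linear V -> V})). Qed.

Fact coact_bilin x : is_bilinear (fun y z : B =>
  \sum_(q <- sweedler x) End_fun (Xreg y) q.1 ⊗ (pi z * q.2) : tensor H H).
Proof.
apply: bilinear_sum => q; split=> v a y z.
  apply: etrans (tensDl _ _ _ _).
  exact: (congr1 (fun f => End_fun f q.1 ⊗ _) (linearP Xreg a y z)).
apply: etrans (tensDr _ _ _ _); congr (_ ⊗ _).
by rewrite (linearP pi) mulrDl -scalerAl.
Qed.

Lemma Xreg_rep h : Xreg (gen_rep H h) = reg h. Proof. exact: ev_rep. Qed.
Lemma Xreg_coc c : Xreg (gen_coc H c) = (alpha c : k) *: ua_one (End_alg H).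
Proof. exact: ev_coc. Qed.
Lemma Xreg_inv c : Xreg (gen_inv H c) = (beta c : k) *: ua_one (End_alg H).
Proof. exact: ev_inv. Qed.

(** Xreg(b) acts on H compatibly with the coaction of H on itself by the
coproduct.  The statement is for all x so that it passes to products. *)
Lemma Xreg_comodule (b : B) (x : H) : comul (End_fun (Xreg b) x) =
  \sum_(p <- sweedler b) \sum_(q <- sweedler x) End_fun (Xreg p.1) q.1 ⊗ (pi p.2 * q.2).
Proof.
have bP := coact_bilin.
pose L x := mk_linear (sweedler_linear (bP x)).
have scalar_case (y : H) (a c : k) (f g : B) :
    Xreg f = a *: ua_one (End_alg H) -> pi g = c%:A ->
    \sum_(q <- sweedler y) End_fun (Xreg f) q.1 ⊗ (pi g * q.2) = (c * a) *: comul y.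
  move=> -> ->; rewrite [comul y](tensor_repr (comul y)) scaler_sumr.
  apply: eq_bigr => q _; rewrite -scalerAl mul1r (bilinZr (tens_bilinear H H)).
  by rewrite [End_fun _ _ ⊗ _](bilinZl (tens_bilinear H H)) scalerA.
elim/uext_ind: b x => [||b c IHb IHc|a b IHb|b c IHb IHc|h|c|c] x.
- by rewrite [RHS](linear0 (L x)) (linear0 Xreg) [LHS]linear0.
- rewrite (sweedler_uext1 (bP x)) (ah_one Xreg) [LHS](tensor_repr (comul x)).
  by apply: eq_bigr => q _; rewrite (ah_one pi) mul1r.
- rewrite [RHS](linearD (L x)) (linearD Xreg) [LHS](linearD comul).
  by rewrite [Y in Y + _]IHb [Y in _ + Y]IHc.
- rewrite [RHS](linearZ_LR (L x)) (linearZ_LR Xreg) [LHS](linearZ_LR comul).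
  by rewrite [Y in _ *: Y]IHb.
- rewrite (sweedler_uextM _ _ (bP x)) [Xreg (b * c)](ah_mul Xreg) [LHS]IHb.
  apply: eq_bigr => p _.
  have b1P : is_bilinear (fun y z => End_fun (Xreg p.1) y ⊗ (pi p.2 * z)).
    split=> v a y z.
      exact: etrans (congr1 (tens^~ _) (End_fun_linear (Xreg p.1) a y z)) (tensDl _ _ _ _).
    by rewrite /= mulrDr -scalerAr tensDr.
  change (tensor_sum (fun y z => End_fun (Xreg p.1) y ⊗ (pi p.2 * z))
      (comul (End_fun (Xreg c) x))
    = \sum_(q <- sweedler c) \sum_(r <- sweedler x)
      End_fun (Xreg (p.1 * q.1)) r.1 ⊗ (pi (p.2 * q.2) * r.2)).
  rewrite IHc tensor_sum_sum //; apply: eq_bigr => q _.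
  rewrite tensor_sum_sum //; apply: eq_bigr => r _.
  rewrite tensor_sumE // [Xreg (p.1 * q.1)](ah_mul Xreg).
  by rewrite [pi (p.2 * q.2)](ah_mul pi) mulrA.
- rewrite (sweedler_gen_rep _ (bP x)) Xreg_rep regE twmul_comul.
  have b1P : is_bilinear (fun y z => twmul y ⊗ mulc H z).
    by split=> v a y z; rewrite /= linearP ?tensDl ?tensDr.
  rewrite (sweedler_tens _ _ b1P); apply: eq_bigr => p _; apply: eq_bigr => q _.
  by rewrite Xreg_rep regE proj_rep mulcE.
- rewrite (sweedler_gen_coc _ (bP x)) Xreg_coc [LHS](linearZ_LR comul).
  under eq_bigr => p _ do rewrite (scalar_case _ _ _ _ _ (Xreg_coc p.1) (proj_coc p.2)).
  by rewrite -scaler_suml (counit_sum2 (W := k^o) alpha).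
- rewrite (sweedler_gen_inv _ (bP x)) Xreg_inv [LHS](linearZ_LR comul).
  under eq_bigr => p _ do rewrite (scalar_case _ _ _ _ _ (Xreg_inv p.2) (proj_inv p.1)).
  by rewrite -scaler_suml (counit_sum1 (W := k^o) beta).
Qed.

Fact gamma_linear : linear (fun b : B => counit (End_fun (Xreg b) 1) : k^o).
Proof.
move=> a b c; rewrite -linearP; congr (counit _).
exact: (congr1 (fun f : End H => End_fun f 1) (linearP Xreg a b c)).
Qed.
(** On A the functional gamma is the character determined by alpha; on B it
extends this character by gamma(a rep(h)) = gamma(a) counit(h). *)
Definition gamma : {linear B -> k^o} := mk_linear gamma_linear.

Lemma Xreg_one b : End_fun (Xreg b) 1 = \sum_(p <- sweedler b) (gamma p.1 : k) *: pi p.2.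
Proof.
have bP : is_bilinear (fun y z : H => (counit y : k) *: z) by exact: tproj2_bilin.
rewrite -[LHS](comul_counitl (End_fun (Xreg b) 1)).
change (tensor_sum (fun y z : H => (counit y : k) *: z) (comul (End_fun (Xreg b) 1))
  = \sum_(p <- sweedler b) (gamma p.1 : k) *: pi p.2).
rewrite Xreg_comodule tensor_sum_sum //; apply: eq_bigr => p _.
rewrite (@sweedler1 k H _ (fun y z => End_fun (Xreg p.1) y ⊗ (pi p.2 * z))).
  by rewrite tensor_sumE // mulr1.
split=> v a y z.
  exact: etrans (congr1 (tens^~ _) (End_fun_linear (Xreg p.1) a y z)) (tensDl _ _ _ _).
by rewrite /= mulrDr -scalerAr tensDr.
Qed.

Section Lift.
Variables (R : unitalAlgebra k) (T : {linear H -> R}).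
Hypothesis T1 : T 1 = ua_one R.
Hypothesis TM : forall x y, T x ⋅ T y =
  \sum_(p <- sweedler x) \sum_(q <- sweedler y)
    (alpha (p.1 ⊗ q.1) : k) *: T (p.2 * q.2).
Local Notation XT := (ev_hom (scal_twisted T1 ab ba TM alpha_lazy)).

Lemma lift_intertwine (b : B) x : XT b ⋅ T x = T (End_fun (Xreg b) x).
Proof.
elim/uext_ind: b x => [||b c IHb IHc|a b IHb|b c IHb IHc|h|c|c] x.
- by rewrite (linear0 XT) (linear0 Xreg) ua_mul0l [RHS]linear0.
- by rewrite (ah_one XT) (ah_one Xreg) ua_mul1l.
- rewrite (linearD XT) (linearD Xreg) ua_mulDl IHb IHc; exact: esym (linearD T _ _).
- rewrite (linearZ_LR XT) (linearZ_LR Xreg) ua_mulZl IHb; exact: esym (linearZ_LR T _ _).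
- by rewrite [XT _](ah_mul XT) [Xreg _](ah_mul Xreg) -ua_mulA IHc IHb.
- rewrite [XT _]ev_rep Xreg_rep regE twmul_tens [LHS]TM linear_sum.
  apply: eq_bigr => p _; rewrite linear_sum; apply: eq_bigr => q _.
  by rewrite linearZ_LR.
- rewrite [XT _]ev_coc Xreg_coc [tw_coc _ _]scalE ua_mulZl ua_mul1l.
  exact: esym (linearZ_LR T _ _).
- rewrite [XT _]ev_inv Xreg_inv [tw_inv _ _]scalE ua_mulZl ua_mul1l.
  exact: esym (linearZ_LR T _ _).
Qed.

Lemma liftE b : XT b = \sum_(p <- sweedler b) (gamma p.1 : k) *: T (pi p.2).
Proof.
rewrite -[LHS]ua_mul1r -T1 lift_intertwine Xreg_one linear_sum.
by apply: eq_bigr => p _; rewrite linearZ_LR.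
Qed.
End Lift.

Lemma gamma1 : gamma 1 = 1.
Proof.
exact: etrans (congr1 (fun f : End H => counit (End_fun f 1)) (ah_one Xreg)) (counit1 H).
Qed.
Let pi_coalg := uext_proj_coalg H.
Let XL : {linear B -> End_alg H} := Xreg.
Let XS : {linear B -> End_alg H} := push Xreg (antipode_lin B).

Fact Xreg_factor : XL = scal gamma ⋆ pull pi_coalg reg.
Proof.
apply: linear_eq => b; rewrite conv_scall.
exact: (liftE (reg_one alpha_norm) (reg_mul alpha_coc)).
Qed.

Fact XL_XS : XL ⋆ XS = cunit.
Proof.
have -> : XL = push Xreg (id_lin B) by apply: linear_eq.
by rewrite -push_conv antipode_convr push_unit.
Qed.
Fact XS_XL : XS ⋆ XL = cunit.
Proof.
have -> : XL = push Xreg (id_lin B) by apply: linear_eq.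
by rewrite -push_conv antipode_convl push_unit.
Qed.

Fact gamma_factor : scal gamma = XL ⋆ pull pi_coalg (tw_dual regt).
Proof.
by rewrite Xreg_factor -convA -pull_conv (tw_dual_convr regt) pull_unit convf1.
Qed.

Fact eval1_linear : linear (fun f : End_alg H => counit (End_fun f 1) : k^o).
Proof. by move=> a f g; rewrite -linearP. Qed.
Let eval1 : {linear End_alg H -> k^o} := mk_linear eval1_linear.

(** The inverse is first found among maps to End(H), and its values are then
turned into scalars by f |-> counit(f 1), which is possible because gamma is
scalar-valued already. *)
Lemma gamma_invertible : conv_invertible gamma.
Proof.
pose G : {linear B -> End_alg H} := pull pi_coalg reg ⋆ XS.
have gG : scal gamma ⋆ G = cunit.
  rewrite gamma_factor /G convA -[XL ⋆ _ ⋆ _]convA -pull_conv (tw_dual_convl regt).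
  by rewrite pull_unit convf1 XL_XS.
have Gg : G ⋆ scal gamma = cunit.
  rewrite gamma_factor /G convA -[X in X ⋆ _]convA XS_XL convf1.
  by rewrite -pull_conv (tw_dual_convr regt) pull_unit.
have eval1_scalar (a : k) : eval1 (a *: ua_one (End_alg H)) = a.
  by rewrite linearZ_LR [eval1 _]counit1; apply: mulr1.
exists (eval1 \o G) => b; split.
- rewrite -[RHS](eval1_scalar (counit b)) -[X in eval1 X]cunitE -gG conv_scall linear_sum.
  by apply: eq_bigr => p _; rewrite linearZ_LR.
- rewrite -[RHS](eval1_scalar (counit b)) -[X in eval1 X]cunitE -Gg conv_scalr linear_sum.
  by apply: eq_bigr => p _; rewrite linearZ_LR; apply: mulrC.
Qed.
End Lifting.

Definition alghom_End (k : fieldType) (A : algType k) (V : lmodType k)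
    (f : alghom (alg_of A) (End_alg V)) : {lrmorphism A -> End V} :=
  HB.pack_for {lrmorphism A -> End V} (f : A -> End V)
    (GRing.isLinear.Build k A (End V) *:%R f (fun a x y => linearP f a x y))
    (GRing.isMonoidMorphism.Build A (End V) f (conj (ah_one f) (ah_mul f))).

Theorem theorem6p7 (k : fieldType) (H : hopfAlgType k)
    (antipode_bij : bijective (antipode : H -> H)) :
  exists (B : hopfAlgType k) (A : B -> Prop) (pi : {lrmorphism B -> H}),
    central_extension A pi /\
    forall (V : lmodType k) (T : {linear H -> End V}),
      projective_representation T -> afforded_by_lazy_2cocycle T ->
      liftable pi T.
Proof.
exists (uext H), (@cocycle_subalg k H), (alghom_lrmorphism (uext_proj H)).
split; first exact: uext_central_extension.
move=> V T [_ T1 _] [alpha [coc norm lz [beta abba] aff]].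
have ab c := (abba c).1; have ba c := (abba c).2.
pose XT := ev_hom (@scal_twisted k H (End_alg V) T alpha beta T1 ab ba aff lz).
exists (alghom_End XT), (gamma coc norm lz ab ba); split.
- exact: gamma_invertible.
- exact: gamma1.
- move=> b; exact: (@liftE k H alpha beta coc norm lz ab ba (End_alg V) T T1 aff b).
Qed.
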